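(* For $1\le m<n$ consider the splitting $\mathbb{R}^n=\mathbb{R}^m\times\mathbb{R}^{n-m}$ with coordinates $x=(x',x'')$, $x'\in\mathbb{R}^m$, $x''\in\mathbb{R}^{n-m}$. Let $g'\in\mathcal{S}(\mathbb{R}^m)\setminus\{0\}$ be any window and let $g''\in\mathcal{S}(\mathbb{R}^{n-m})$ be given by $$g''(x'')=(2\pi\hbar)^{-(n-m)/2}e^{-\frac1{2\hbar}\langle x'',Qx''\rangle},$$ where $Q$ is the $(n-m)\times(n-m)$ diagonal matrix with strictly positive eigenvalues $q_{m+1},\dots,q_n$. Then, regarding $\mathbb{R}^m$ as a subspace of $\mathbb{R}^n$ via the inclusion $x'\mapsto(x',0)$, for every $f\in M^{\infty,1}(\mathbb{R}^n)$ we have $f|_{\mathbb{R}^m}\in M^{\infty,1}(\mathbb{R}^m)$ with $$\|f|_{\mathbb{R}^m}\|_{M^{\infty,1}_{(g')}(\mathbb{R}^m)}\le\|f\|_{M^{\infty,1}_{(g'\otimes g'')}(\mathbb{R}^n)}.$$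
   Context: Fix $\hbar\in(0,1]$. For $g\in\mathcal{S}(\mathbb{R}^d)$ and $f\in\mathcal{S}'(\mathbb{R}^d)$, the Gabor transform $V_gf(x,\xi)$ is the value at $\xi$ of the Fourier transform of $f\,\overline{g(\cdot-x)}$, with the normalization $V_gf(x,\xi)=(2\pi\hbar)^{-d/2}\int_{\mathbb{R}^d}e^{-\frac i\hbar\xi\cdot y}f(y)\overline{g(y-x)}\,dy$ for functions. $\|f\|_{M^{\infty,1}_{(g)}(\mathbb{R}^d)}=\int_{\mathbb{R}^d}\sup_{x\in\mathbb{R}^d}|V_gf(x,\xi)|\,d\xi$, and $M^{\infty,1}(\mathbb{R}^d)$ is the space of $f\in\mathcal{S}'(\mathbb{R}^d)$ for which this is finite for some (equivalently every) $g\in\mathcal{S}(\mathbb{R}^d)\setminus\{0\}$. Elements of $M^{\infty,1}(\mathbb{R}^d)$ are identified with bounded continuous functions, so restriction is defined pointwise. $(g'\otimes g'')(x',x'')=g'(x')g''(x'')$. *)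

(* Defs.v *)
From HB Require Import structures.
From mathcomp Require Import all_boot all_order all_algebra.
From mathcomp Require Import complex.
From mathcomp Require Import all_classical all_reals all_analysis.

Set Implicit Arguments.
Unset Strict Implicit.
Unset Printing Implicit Defensive.

Import Order.TTheory GRing.Theory Num.Theory.
Import numFieldNormedType.Exports.
Import Normc.

Local Open Scope classical_set_scope.
Local Open Scope ring_scope.

Definition measure_rV_display : measure_display -> measure_display.
Proof. exact. Qed.

Section measurable_rV.
Context {d} {T : sigmaRingType d}.
Variable n : nat.

(* R^n carries the sigma-algebra generated by the coordinates, i.e. the Borel
   sigma-algebra when T = R. *)
Let coord : 'I_n -> 'rV[T]_n -> T := fun i x => x ord0 i.

Let rV_set0 : g_sigma_preimage coord set0.
Proof. exact: sigma_algebra0. Qed.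

Let rV_setC A : g_sigma_preimage coord A -> g_sigma_preimage coord (~` A).
Proof. exact: sigma_algebraC. Qed.

Let rV_bigcup (F : _^nat) : (forall i, g_sigma_preimage coord (F i)) ->
  g_sigma_preimage coord (\bigcup_i (F i)).
Proof. exact: sigma_algebra_bigcup. Qed.

HB.instance Definition _ := @isMeasurable.Build (measure_rV_display d)
  'rV[T]_n (g_sigma_preimage coord) rV_set0 rV_setC rV_bigcup.

End measurable_rV.

Lemma measurable_coord d (T : sigmaRingType d) n (i : 'I_n) :
  measurable_fun [set: 'rV[T]_n] (fun x => x ord0 i).
Proof.
move=> _ Y mY; rewrite setTI; apply: sub_sigma_algebra => /=.
rewrite -bigcup_seq/=; exists i => /=; first by rewrite mem_index_enum.
by exists Y => //; rewrite setTI.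
Qed.

Lemma measurable_fun_coordP d1 d2 (T1 : measurableType d1)
    (T2 : measurableType d2) n (f : T1 -> 'rV[T2]_n) :
  (forall i, measurable_fun [set: T1] (fun x => f x ord0 i)) ->
  measurable_fun [set: T1] f.
Proof.
move=> mf _ A mA; rewrite setTI.
suff : <<s \big[setU/set0]_(i < n) preimage_set_system setT
    (fun x : 'rV[T2]_n => x ord0 i) measurable >> `<=`
    [set B | measurable (f @^-1` B)] by apply.
apply: smallest_sub.
  split => /=; first by rewrite preimage_set0.
    by move=> B mB; rewrite setTD preimage_setC; exact: measurableC.
  by move=> F mF; rewrite preimage_bigcup; exact: bigcupT_measurable.
rewrite -bigcup_seq => B /= [i _ [C mC <-]].
rewrite setTI -[X in measurable X]setTI; exact: (mf i).
Qed.

Section lebesgue_rV.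
Context {R : realType}.
Variable n : nat.

Definition rV_cons (p : measurableTypeR R * 'rV[R]_n) : 'rV[R]_n.+1 :=
  row_mx (p.1%:M : 'M[R]_1) p.2.

Lemma measurable_rV_cons : measurable_fun [set: _] rV_cons.
Proof.
apply: measurable_fun_coordP => i.
case: (split_ordP (i : 'I_(1 + n))) => j ->.
  rewrite (_ : (fun _ => _) = fst); first exact: measurable_fst.
  by apply/funext => -[t x]; rewrite /rV_cons (row_mxEl _ _ ord0 j) !ord1 mxE.
rewrite (_ : (fun _ => _) = (fun x : 'rV[R]_n => x ord0 j) \o snd).
  by apply: measurableT_comp; [exact: measurable_coord|exact: measurable_snd].
apply/funext => -[t x]; exact: (row_mxEr _ _ ord0 j).
Qed.

HB.instance Definition _ := isMeasurableFun.Build _ _ _ _ rV_cons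
  measurable_rV_cons.

Variable mu : {sigma_finite_measure set 'rV[R]_n -> \bar R}.

Definition lebesgue_rV_step : set 'rV[R]_n.+1 -> \bar R :=
  pushforward (lebesgue_measure \x mu)%E rV_cons.

Let step0 : lebesgue_rV_step set0 = 0%E.
Proof. exact: measure0. Qed.

Let step_ge0 A : (0 <= lebesgue_rV_step A)%E.
Proof. exact: measure_ge0. Qed.

Let step_additive : semi_sigma_additive lebesgue_rV_step.
Proof. exact: measure_semi_sigma_additive. Qed.

HB.instance Definition _ := isMeasure.Build _ _ _ lebesgue_rV_step
  step0 step_ge0 step_additive.

Let step_sigma_finite : sigma_finite setT lebesgue_rV_step.
Proof.
have [F TF mF] : sigma_finite setT (@lebesgue_measure R \x mu)%E.
  have /sigma_finiteP[F [TF ndF Foo]] := sigma_finiteT (@lebesgue_measure R).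
  have /sigma_finiteP[G [TG ndG Goo]] := sigma_finiteT mu.
  exists (fun k => F k `*` G k).
    rewrite -setXTT TF TG predeqE => -[x y]; split.
      move=> [/= [i _ Fix] [j _ Gjy]]; exists (maxn i j) => //; split.
      - by move: x Fix; exact/subsetPset/ndF/leq_maxl.
      - by move: y Gjy; exact/subsetPset/ndG/leq_maxr.
    by move=> [i _ []/= ? ?]; split; exists i.
  move=> k; have [? ?] := Foo k; have [? ?] := Goo k.
  split; first exact: measurableX.
  by rewrite product_measure1E// lte_mul_pinfty// ge0_fin_numE.
pose u (x : 'rV[R]_(1 + n)) : measurableTypeR R * 'rV[R]_n :=
  (x ord0 (lshift n ord0), rsubmx x).
have uK : cancel rV_cons u.
  by move=> [t x]; rewrite /u /rV_cons row_mxKr row_mxEl mxE.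
have Ku : cancel u rV_cons.
  move=> x; rewrite /u /rV_cons /= -[RHS](hsubmxK (x : 'rV[R]_(1 + n))).
  congr row_mx; apply/matrixP => i j; rewrite !ord1 !mxE eqxx mulr1n.
  by congr (x _ _); exact/val_inj.
have mu_ : measurable_fun [set: 'rV[R]_n.+1] u.
  apply/measurable_fun_pairP; split; first exact: measurable_coord.
  apply: measurable_fun_coordP => i.
  rewrite (_ : (fun _ => _) = fun x : 'rV[R]_(1 + n) => x ord0 (rshift 1 i)).
    exact: measurable_coord.
  by apply/funext => x; rewrite /= mxE.
exists (fun k => u @^-1` F k).
  by rewrite -preimage_bigcup -TF preimage_setT.
move=> k; have [mFk Fk] := mF k; split.
  by rewrite -[X in measurable X]setTI; exact: mu_.
rewrite /lebesgue_rV_step /pushforward -comp_preimage.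
by rewrite (_ : u \o rV_cons = id) ?preimage_id//; exact/funext.
Qed.

HB.instance Definition _ := Measure_isSigmaFinite.Build _ _ _ lebesgue_rV_step
  step_sigma_finite.

End lebesgue_rV.

Fixpoint lebesgue_rV (R : realType) n :
    {sigma_finite_measure set 'rV[R]_n -> \bar R} :=
  match n with
  | 0 => \d_(0 : 'rV[R]_0)
  | n'.+1 => lebesgue_rV_step (lebesgue_rV R n')
  end.

Section complex_valued.
Context {R : realType}.
Implicit Types theta : R.

Definition expi theta : R[i] := (cos theta +i* sin theta)%C.

(* R[i] carries no measurable or normed-module structure over R in the
   libraries, so integrals, continuity and derivatives of complex-valued
   functions are taken on real and imaginary parts. *)
Definition Cintegral d (T : measurableType d) (mu : {measure set T -> \bar R})
    (f : T -> R[i]) : R[i] :=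
  ((Rintegral mu setT (@complex.Re R \o f)) +i*
   (Rintegral mu setT (@complex.Im R \o f)))%C.

Definition dotrV n (x y : 'rV[R]_n) : R := (x *m y^T) ord0 ord0.

Fixpoint partial n (s : seq 'I_n) (f : 'rV[R]_n -> R) : 'rV[R]_n -> R :=
  if s is j :: s' then 'D_(delta_mx ord0 j) (partial s' f) else f.

Definition Cpartial n (s : seq 'I_n) (f : 'rV[R]_n -> R[i]) (x : 'rV[R]_n) :
    R[i] :=
  (partial s (@complex.Re R \o f) x +i* partial s (@complex.Im R \o f) x)%C.

Definition smooth n (f : 'rV[R]_n -> R) : Prop :=
  forall s : seq 'I_n, continuous (partial s f) /\
    forall (j : 'I_n) (x : 'rV[R]_n),
      derivable (partial s f) x (delta_mx ord0 j).

Definition Csmooth n (f : 'rV[R]_n -> R[i]) : Prop :=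
  smooth (@complex.Re R \o f) /\ smooth (@complex.Im R \o f).

Definition bounded_continuous n (f : 'rV[R]_n -> R[i]) : Prop :=
  [/\ continuous (@complex.Re R \o f), continuous (@complex.Im R \o f) &
      exists M : R, forall x, normc (f x) <= M].

End complex_valued.

Section schwartz.
Context {R : realType} {n : nat}.
Implicit Types (phi psi : 'rV[R]_n -> R[i]) (N : nat).

(* The norm `|x| on 'rV[R]_n is the sup norm; the increasing family
   (schwartz_norm N) generates the usual topology of S(R^n). *)
Definition schwartz_norm N phi : \bar R :=
  ereal_sup [set y | exists k (s : seq 'I_n) (x : 'rV[R]_n),
    [/\ (k <= N)%N, (size s <= N)%N &
        y = (`|x| ^+ k * normc (Cpartial s phi x))%:E]].

Definition schwartz phi : Prop :=
  Csmooth phi /\ forall N, (schwartz_norm N phi < +oo)%E.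

(* A distribution is encoded as a functional on all functions R^n -> C; only
   its values on Schwartz functions are meaningful, and everything below
   depends only on those. *)
Definition distribution_on : Type := ('rV[R]_n -> R[i]) -> R[i].
Implicit Type f : distribution_on.

Definition tempered f : Prop :=
  (forall (a : R[i]) phi psi, schwartz phi -> schwartz psi ->
     f (fun x => a * phi x + psi x) = a * f phi + f psi) /\
  (exists N (C : R), forall phi, schwartz phi ->
     ((normc (f phi))%:E <= C%:E * schwartz_norm N phi)%E).

Definition distribution_of (F : 'rV[R]_n -> R[i]) : distribution_on :=
  fun phi => Cintegral (lebesgue_rV R n) (fun x => F x * phi x).

Definition eq_distribution f1 f2 : Prop :=
  forall phi, schwartz phi -> f1 phi = f2 phi.

End schwartz.
Arguments distribution_on : clear implicits.

Section modulation.
Context {R : realType} {n : nat}.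
Implicit Types (f : distribution_on R n) (g : 'rV[R]_n -> R[i]).
Implicit Types (hbar : R) (x xi y : 'rV[R]_n).

(* The value at xi of the semiclassical Fourier transform of the tempered
   distribution f * conj(g(. - x)): the pairing (without conjugation) of f with
   y |-> e^(- i xi.y / hbar) conj(g(y - x)), times (2 pi hbar)^(-n/2). *)
Definition gabor hbar g f x xi : R[i] :=
  ((2 * pi * hbar) `^ (- (n%:R / 2)))%:C%C *
  f (fun y => expi (- (hbar^-1 * dotrV xi y)) * ((g (y - x))^*)%C).

Definition normM hbar g f : \bar R :=
  (\int[lebesgue_rV R n]_xi
     ereal_sup (range (fun x => (normc (gabor hbar g f x xi))%:E)))%E.

Definition window g : Prop := schwartz g /\ g <> (fun=> 0).

Definition in_M hbar f : Prop :=
  tempered f /\ exists g, window g /\ (normM hbar g f < +oo)%E.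

End modulation.

Section splitting.
Context {R : realType} {m k : nat}.

Definition tensor (g1 : 'rV[R]_m -> R[i]) (g2 : 'rV[R]_k -> R[i])
    (x : 'rV[R]_(m + k)) : R[i] := g1 (lsubmx x) * g2 (rsubmx x).

(* Restriction acts on the bounded continuous representative F of an element f
   of M^(oo,1), i.e. eq_distribution f (distribution_of F). *)
Definition restriction (F : 'rV[R]_(m + k) -> R[i]) (x : 'rV[R]_m) : R[i] :=
  F (row_mx x 0).

End splitting.

Definition gaussian_window (R : realType) k (hbar : R) (Q : 'M[R]_k)
    (x : 'rV[R]_k) : R[i] :=
  ((2 * pi * hbar) `^ (- (k%:R / 2)) *
   expR (- ((2 * hbar)^-1 * dotrV x (x *m Q^T))))%:C%C.

(* Main.v *)
(* Fourier inversion in the last k = n - m variables, at the origin: with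
   x = (x', x''), the integral of V_g F (x, (xi', z)) over z in R^k equals
   (2 pi hbar)^(k/2) times the Gabor transform of F(., 0) at (x', xi') for the
   window g(., -x'').  Taking absolute values, the supremum over x' and the
   integral over xi' bounds the norm of the restriction.  With x'' = 0 and
   g = g' (x) g'' the slice of the window is (2 pi hbar)^(-k/2) g', which gives
   the constant 1; applied to an arbitrary window g with a nonzero slice, the
   same bound shows that the restriction belongs to M^(oo,1), so independence of
   the space from the window is never needed.
   Only an inequality is required, hence no integrability of V_g F: the integral
   in z is damped by a product of factors exp(- eps |z_j| / hbar), whose Fourier
   transform is a product of Poisson kernels, and eps tends to 0. *)

Require Import Defs.
From mathcomp Require Import all_boot all_order all_algebra.
From mathcomp Require Import complex ring lra.
From mathcomp Require Import all_classical all_reals all_analysis.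
From mathcomp Require Import measurable_realfun.

Set Implicit Arguments.
Unset Strict Implicit.
Unset Printing Implicit Defensive.

Import Order.TTheory GRing.Theory Num.Theory.
Import numFieldNormedType.Exports.
Import Normc.

Local Open Scope classical_set_scope.
Local Open Scope ring_scope.

(** * Borel sets and Lebesgue integrals on R^n *)

Section borel_rV.
Context {R : realType}.

(** Every estimate is reduced to real integrals. A factor [u] of modulus at most 1 rotates the slice
    transform onto the nonnegative axis, so its modulus is the integral of one real function, and
    the inversion step becomes a one-sided bound for a pair [P], [Q] of real and imaginary parts; a
    majorant [T] with infinite integral is then harmless. The damping exp(-a |t|) has an elementary
    transform in one variable, and a dilation turns the Poisson kernel into the fixed weight [decw],
    independent of the damping. The limit therefore acts only on the argument of a continuous
    function, and dominated convergence is enough; the integral of [decw] over R^k is pi^k, which is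
    the origin of the factor (2 pi hbar)^k. Two obstacles account for most of the rest. The supremum
    over an uncountable set of [x] must be measurable in [xi], which follows from lower
    semicontinuity. And a distribution is known only on Schwartz functions, so modulated windows,
    slices and Gaussian tensors must be shown to be Schwartz, all iterated derivatives included. *)

Lemma norm_coord_le n (x : 'rV[R]_n) i : `|x ord0 i| <= `|x|.
Proof.
rewrite [leRHS]mx_normrE.
exact: (le_bigmax_cond 0 (fun ij : 'I_1 * 'I_n => `|x ij.1 ij.2|) (j := (ord0, i))).
Qed.

Lemma norm_rV_le n (x : 'rV[R]_n) (c : R) : 0 <= c ->
  (forall i, `|x ord0 i| <= c) -> `|x| <= c.
Proof.
move=> c0 xc; rewrite [leLHS]mx_normrE.
by apply/bigmax_leP; split => // -[i j] _ /=; rewrite ord1.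
Qed.

(** The sigma-algebra is generated by the coordinates, not by the topology. Balls of the sup norm
    are cubes, and an open set is the union of the cubes of rational centre and radius 1/(k+1) that
    it contains, a countable family. *)
Lemma open_measurable_rV n (A : set 'rV[R]_n) : open A -> measurable A.
Proof.
move=> oA.
pose B (p : {ffun 'I_n -> rat} * nat) : set 'rV[R]_n :=
  \bigcap_(i in [set: 'I_n])
    ((fun x : 'rV[R]_n => x ord0 i) @^-1` ball (ratr (p.1 i) : R) (p.2.+1%:R^-1)).
have mB p : measurable (B p).
  apply: fin_bigcap_measurable => [|i _]; first exact: finite_finset.
  rewrite -[X in measurable X]setTI; apply: measurable_coord => //.
  by apply: measurable_ball.
rewrite (_ : A = \bigcup_p (if `[< B p `<=` A >] then B p else set0)).
  apply: countable_bigcupT_measurable; first exact: countableP.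
  by move=> p; case: ifP.
apply/seteqP; split => [x Ax|x [p _]]; last by case: asboolP => // BA /BA.
move: oA; rewrite openE => /(_ _ Ax) /nbhs_ballP[e /= e0 xeA].
(* Half of [e], since a point of the cube is reached from [x] through the rational centre. *)
have [k ke] : exists k, k.+1%:R^-1 < e / 2 :> R.
  have e20 : 0 < e / 2 by rewrite divr_gt0.
  have [k _ kP] := near_infty_natSinv_lt (PosNum e20).
  by exists k; exact: (kP k (leqnn k)).
have /choice[q qP] i : exists r : rat, `|ratr r - x ord0 i| < k.+1%:R^-1.
  have /rat_in_itvoo[r] : x ord0 i < x ord0 i + k.+1%:R^-1 by rewrite ltrDl invr_gt0.
  rewrite in_itv/= => /andP[r1 r2]; exists r.
  by rewrite ger0_norm ?ltrBlDl// subr_ge0 ltW.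
pose p := ([ffun i => q i], k).
have Bx : B p x by move=> i _ /=; rewrite -ball_normE /= ffunE.
exists p => //; case: asboolP => // -[] y By.
apply: xeA; split => // i j; rewrite ord1 -ball_normE /=.
have := By j I; have := Bx j I; rewrite -ball_normE /= => xj yj.
rewrite -(subrK (ratr (p.1 j)) (x ord0 j)) -addrA.
rewrite (le_lt_trans (ler_normD _ _))// [ltRHS](splitr e) ltrD//.
  by rewrite distrC (lt_trans xj).
by rewrite (lt_trans yj).
Qed.

Lemma continuous_measurable_rV n (f : 'rV[R]_n -> R) : continuous f ->
  measurable_fun [set: 'rV[R]_n] f.
Proof.
move=> cf.
apply: (measurability _ (RGenOpens.measurableE R)) => _ [_ [a [b ->]] <-].
rewrite setTI; apply: open_measurable_rV.
by apply: open_comp => [x _|]; [exact: cf|exact: interval_open].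
Qed.
End borel_rV.

(** * Tonelli, dilations and product functions for [lebesgue_rV] *)

Section integration_rV.
Context {R : realType}.
Local Notation leb := (@lebesgue_measure R).
Local Notation mu := (@lebesgue_rV R).

Lemma rV_cons_ord0 n t (x : 'rV[R]_n) : rV_cons (t, x) ord0 ord0 = t.
Proof.
transitivity (row_mx (t%:M : 'M[R]_1) x ord0 (lshift n ord0)).
  by congr (row_mx _ _ _ _); exact/val_inj.
by rewrite row_mxEl mxE.
Qed.

Lemma rV_cons_lift n t (x : 'rV[R]_n) j :
  rV_cons (t, x) ord0 (lift ord0 j) = x ord0 j.
Proof.
transitivity (row_mx (t%:M : 'M[R]_1) x ord0 (rshift 1 j)).
  by congr (row_mx _ _ _ _); exact/val_inj.
by rewrite row_mxEr.
Qed.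

Lemma row_mx_rV_cons m k t (x : 'rV[R]_m) (y : 'rV[R]_k) :
  row_mx (rV_cons (t, x)) y = rV_cons (t, row_mx x y).
Proof.
rewrite /rV_cons /=.
(* The sizes in the associativity cast are convertible, so the cast is the identity. *)
have /= -> := @row_mxA _ _ _ _ _ (t%:M : 'M[R]_1) x y.
by rewrite castmx_id.
Qed.

Lemma measurable_row_mx m k :
  measurable_fun [set: 'rV[R]_m * 'rV[R]_k] (fun p => row_mx p.1 p.2).
Proof.
apply: measurable_fun_coordP => i.
case: (split_ordP i) => j ->.
  rewrite (_ : (fun _ => _) = (fun x : 'rV[R]_m => x ord0 j) \o fst).
    by apply: measurableT_comp; [exact: measurable_coord|exact: measurable_fst].
  by apply/funext => p /=; rewrite row_mxEl.
rewrite (_ : (fun _ => _) = (fun x : 'rV[R]_k => x ord0 j) \o snd).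
  by apply: measurableT_comp; [exact: measurable_coord|exact: measurable_snd].
by apply/funext => p /=; rewrite row_mxEr.
Qed.

Local Open Scope ereal_scope.

Lemma ge0_integral_rVS n (f : 'rV[R]_n.+1 -> \bar R) :
  measurable_fun setT f -> (forall x, 0 <= f x) ->
  \int[mu n.+1]_x f x = \int[leb]_t \int[mu n]_x f (rV_cons (t, x)).
Proof.
move=> mf f0.
rewrite (ge0_integral_pushforward (@measurable_rV_cons R n) (leb \x mu n))//.
rewrite preimage_setT fubini_tonelli1//=.
by apply: measurableT_comp => //; exact: measurable_rV_cons.
Qed.

(** The measure is built one coordinate at a time, so a splitting into two blocks is reached by
    induction on [m], peeling off the first coordinate; at m = 0 the measure is the Dirac mass at
    the only point of R^0. *)
Lemma ge0_integral_row_mx m k (f : 'rV[R]_(m + k) -> \bar R) :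
  measurable_fun setT f -> (forall x, 0 <= f x) ->
  \int[mu (m + k)]_x f x = \int[mu m]_x \int[mu k]_y f (row_mx x y).
Proof.
elim: m f => [|m ih] f mf f0.
  rewrite integral_dirac//=; last first.
    apply: (measurable_fun_fubini_tonelli_F (m2 := mu k)
      (fun p => f (row_mx p.1 p.2))) => //.
    by apply: measurableT_comp => //; exact: measurable_row_mx.
  rewrite diracT mul1e; apply: eq_integral => y _; congr (f _).
  by rewrite [RHS]row_thin_mx.
rewrite [LHS](@ge0_integral_rVS (m + k))// [RHS]ge0_integral_rVS//; last 2 first.
- apply: (measurable_fun_fubini_tonelli_F (m2 := mu k)
      (fun p => f (row_mx p.1 p.2))) => //.
  by apply: measurableT_comp => //; exact: measurable_row_mx.
- by move=> x; exact: integral_ge0.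
apply: eq_integral => t _; rewrite ih//; last first.
  apply: measurableT_comp => //.
  apply: (measurableT_comp (@measurable_rV_cons R _)).
  exact: measurable_pair1.
apply: eq_integral => x _; apply: eq_integral => y _.
by rewrite row_mx_rV_cons.
Qed.

Lemma measurable_comp_row_mx m k (f : 'rV[R]_(m + k) -> \bar R) :
  measurable_fun setT f ->
  measurable_fun setT (fun p : 'rV[R]_m * 'rV[R]_k => f (row_mx p.1 p.2)).
Proof. by move=> mf; apply: measurableT_comp => //; exact: measurable_row_mx. Qed.

Lemma integral_row_mx m k (f : 'rV[R]_(m + k) -> \bar R) :
  measurable_fun setT f ->
  \int[mu (m + k)]_x f x = \int[mu m \x mu k]_p f (row_mx p.1 p.2).
Proof.
move=> mf; rewrite integralE [RHS]integralE.
have mfr := measurable_comp_row_mx mf.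
congr (_ - _); rewrite ge0_integral_row_mx ?fubini_tonelli1//.
- apply: eq_integral => x _; apply: eq_integral => y _.
  by rewrite !funeposE.
- exact: measurable_funepos.
- exact: measurable_funepos.
- apply: eq_integral => x _; apply: eq_integral => y _.
  by rewrite !funenegE.
- exact: measurable_funeneg.
- exact: measurable_funeneg.
Qed.

Lemma integrable_row_mx m k (f : 'rV[R]_(m + k) -> \bar R) :
  (mu (m + k)).-integrable setT f ->
  (mu m \x mu k).-integrable setT (fun p => f (row_mx p.1 p.2)).
Proof.
move=> /integrableP[mf fi]; apply/integrableP; split.
  exact: measurable_comp_row_mx.
by rewrite -(integral_row_mx (f := abse \o f))//; exact: measurableT_comp.
Qed.

(** The image of Lebesgue measure under multiplication by [c], scaled by [c], gives each half-open
    interval its length, hence is Lebesgue measure by uniqueness. *)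
Lemma ge0_integral_scale (c : R) (g : measurableTypeR R -> \bar R) : (0 < c)%R ->
  measurable_fun setT g -> (forall x, 0 <= g x) ->
  c%:E * \int[leb]_t g (c * t)%R = \int[leb]_t g t.
Proof.
move=> c0 mg g0.
have mc : measurable_fun [set: measurableTypeR R]
  (( *%R c : _ -> measurableTypeR R)) by exact: mulrl_measurable.
pose cmu := pushforward leb ( *%R c : _ -> measurableTypeR R).
have -> : \int[leb]_t g (c * t)%R = \int[cmu]_t g t.
  by rewrite (ge0_integral_pushforward mc leb (D := setT)).
rewrite -(ge0_integral_mscale cmu measurableT (NngNum (ltW c0)))//.
apply: eq_measure_integral => A mA _; apply/esym.
apply: lebesgue_measure_unique => //= _ [[a b]] _ <-.
rewrite /mscale /= /cmu /pushforward.
rewrite (_ : _ @^-1` _ = `](a / c)%R, (b / c)%R]%classic); last first.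
  apply/seteqP; split => t /=; rewrite !in_itv/=;
  by rewrite ltr_pdivrMr// ler_pdivlMr// ![(t * c)%R]mulrC.
rewrite !lebesgue_measure_itv/= !lte_fin ltr_pM2r ?invr_gt0//.
by case: ifPn => _; rewrite ?mule0// -!EFinB -EFinM -mulrBl mulrC divfK// gt_eqF.
Qed.

Lemma measurable_scale_rV k (c : R) :
  measurable_fun [set: 'rV[R]_k] (fun x : 'rV[R]_k => c *: x).
Proof.
apply: measurable_fun_coordP => i; under eq_fun do rewrite mxE.
by apply: measurable_funM => //; exact: measurable_coord.
Qed.

Lemma ge0_integral_rV_scale k (c : R) (f : 'rV[R]_k -> \bar R) : (0 < c)%R ->
  measurable_fun setT f -> (forall x, 0 <= f x) ->
  (c ^+ k)%:E * \int[mu k]_x f (c *: x) = \int[mu k]_x f x.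
Proof.
move=> c0; elim: k f => [|k ih] f mf f0.
  rewrite expr0 mul1e; apply: eq_integral => x _; congr f.
  by apply/rowP => -[].
have mfc := measurableT_comp mf (measurable_scale_rV (k := k.+1) c).
rewrite [RHS]ge0_integral_rVS// ge0_integral_rVS//=.
rewrite -[RHS](@ge0_integral_scale c)//; last 2 first.
- apply: (measurable_fun_fubini_tonelli_F (m2 := mu k)
    (fun p => f (rV_cons p))) => //.
  by apply: measurableT_comp => //; exact: measurable_rV_cons.
- by move=> t; exact: integral_ge0.
rewrite exprS EFinM -muleA; congr (_ * _).
rewrite -ge0_integralZl//; last 3 first.
- apply: (measurable_fun_fubini_tonelli_F (m2 := mu k)
    (fun p => f (c *: rV_cons p))) => //.
  by apply: (measurableT_comp mfc); exact: measurable_rV_cons.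
- by move=> t _; exact: integral_ge0.
- by rewrite lee_fin exprn_ge0// ltW.
- apply: eq_integral => t _; rewrite -[RHS]ih//; last first.
    apply: measurableT_comp => //.
    by apply: (measurableT_comp (@measurable_rV_cons R _)); exact: measurable_pair1.
  congr (_ * _); apply: eq_integral => x _; congr f.
  by rewrite /rV_cons [LHS](scale_row_mx c (t%:M : 'M[R]_1) x) scale_scalar_mx.
Qed.

Lemma ge0_integral_rV_prod k (h : R -> R) (I : R) :
  measurable_fun setT h -> (forall t, (0 <= h t)%R) ->
  \int[leb]_t (h t)%:E = I%:E ->
  \int[mu k]_x (\prod_(j < k) h (x ord0 j))%:E = (I ^+ k)%:E.
Proof.
move=> mh h0 hI; elim: k => [|k ih].
  rewrite expr0 integral_dirac//= ?diracT ?mul1e ?big_ord0//.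
  by under eq_fun do rewrite big_ord0; exact: measurable_cst.
have mp l : measurable_fun [set: 'rV[R]_l]
    (fun x => (\prod_(j < l) h (x ord0 j))%:E).
  apply/measurable_EFinP; apply: measurable_prod => j _.
  by apply: measurableT_comp => //; exact: measurable_coord.
have p0 l (x : 'rV[R]_l) : (0 <= \prod_(j < l) h (x ord0 j))%R.
  by apply: prodr_ge0 => j _.
rewrite ge0_integral_rVS//; last by move=> x; rewrite lee_fin.
transitivity (\int[leb]_t ((h t)%:E * (I ^+ k)%:E)).
  apply: eq_integral => t _; rewrite -ih -ge0_integralZl//; last 3 first.
  - exact: mp.
  - by move=> x _; rewrite lee_fin.
  - by rewrite lee_fin.
  apply: eq_integral => x _; rewrite big_ord_recl rV_cons_ord0 EFinM.
  by under eq_bigr do rewrite rV_cons_lift.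
rewrite ge0_integralZr//=.
- by rewrite hI -EFinM exprS.
- exact/measurable_EFinP.
- by move=> x _; rewrite lee_fin.
- by rewrite -ih integral_ge0// => x _; rewrite lee_fin.
Qed.

End integration_rV.

(** * The Poisson kernel *)

Section poisson1.
Context {R : realType}.
Implicit Types a b t : R.
Local Notation leb := (@lebesgue_measure R).

Lemma is_derive_mull c t : is_derive t 1 (fun s : R => c * s) c.
Proof.
have -> : (fun s : R => c * s) = c \*: (@id R) by apply/funext => s.
by apply: is_derive_eq; rewrite scaler1.
Qed.

(** The real part of the antiderivative of exp(-(a - i b) t), plus the antiderivative of exp(-a t).
    Both vanish at infinity, so a half-line integral is minus the value at 0. *)
Let F a b t : R :=
  expR (- a * t) * ((a ^+ 2 + b ^+ 2)^-1 * (b * sin (b * t) - a * cos (b * t))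
                    - a^-1).

Let F_derive a b t : 0 < a ->
  is_derive t 1 (F a b) (expR (- a * t) * (1 + cos (b * t))).
Proof.
move=> a0.
have dE : is_derive t 1 (fun s => expR (- a * s)) (- a * expR (- a * t)).
  have := is_derive1_comp (is_derive_expR (- a * t)) (is_derive_mull (- a) t).
  by move/is_derive_eq; apply; rewrite mulrC.
have ds : is_derive t 1 (fun s => sin (b * s)) (b * cos (b * t)).
  have := is_derive1_comp (is_derive_sin (b * t)) (is_derive_mull b t).
  by move/is_derive_eq; apply; rewrite mulrC.
have dc : is_derive t 1 (fun s => cos (b * s)) (- b * sin (b * t)).
  have := is_derive1_comp (is_derive_cos (b * t)) (is_derive_mull b t).
  by move/is_derive_eq; apply; ring.
have := is_deriveM dE (is_deriveB (is_deriveZ (a ^+ 2 + b ^+ 2)^-1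
  (is_deriveB (is_deriveZ b ds) (is_deriveZ a dc))) (is_derive_cst a^-1 t 1)).
move/is_derive_eq; apply.
rewrite !fctE /= /GRing.scale /=.
have ab0 : a ^+ 2 + b ^+ 2 != 0.
  by rewrite gt_eqF// ltr_wpDr ?sqr_ge0// exprn_gt0.
by field; rewrite ab0 gt_eqF.
Qed.

Let F_cvg a b : 0 < a -> F a b t @[t --> +oo] --> (0 : R).
Proof.
move=> a0.
pose K := (a ^+ 2 + b ^+ 2)^-1 * (`|b| + a) + a^-1.
have ab0 : 0 < a ^+ 2 + b ^+ 2 by rewrite ltr_wpDr ?sqr_ge0// exprn_gt0.
have cE : expR (- a * t) @[t --> +oo] --> (0 : R).
  rewrite (_ : (fun x => expR (- a * x)) =
               (fun z => expR (- z)) \o (fun z => a * z)); last first.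
    by apply: eq_fun => x; rewrite mulNr.
  apply: (@cvg_comp _ _ _ _ _ _ (pinfty_nbhs R)); last exact: cvgr_expR.
  exact: gt0_cvgMry.
apply: (@squeeze_cvgr _ _ _ _ (fun t => - (K * expR (- a * t)))
                              (fun t => K * expR (- a * t))).
- apply: nearW => t; rewrite -ler_norml /F normrM (ger0_norm (expR_ge0 _)).
  rewrite [leLHS]mulrC ler_wpM2r ?expR_ge0//.
  rewrite (le_trans (ler_normB _ _))// lerD//; last by rewrite gtr0_norm ?invr_gt0.
  rewrite normrM gtr0_norm ?invr_gt0// ler_wpM2l ?invr_ge0 ?(ltW ab0)//.
  rewrite (le_trans (ler_normB _ _))// !normrM lerD//.
    by rewrite ler_piMr// ler_norml sin_geN1 sin_le1.
  by rewrite (gtr0_norm a0) ler_piMr ?(ltW a0)// ler_norml cos_geN1 cos_le1.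
- rewrite -oppr0; apply: cvgN; rewrite -(mulr0 K).
  by apply: cvgM => //; exact: cvg_cst.
- by rewrite -(mulr0 K); apply: cvgM => //; exact: cvg_cst.
Qed.

Let continuous_mull c : continuous (fun s : R => c * s).
Proof. exact: mulrl_continuous. Qed.

(* Adding 1 to the cosine makes the integrand nonnegative, as required by the
   fundamental theorem of calculus on a half-line. *)
Lemma integral_expR_1cos a b : 0 < a ->
  (\int[leb]_t (expR (- (a * `|t|)) * (1 + cos (b * t)))%:E =
   (2 / a + 2 * a / (a ^+ 2 + b ^+ 2))%:E)%E.
Proof.
move=> a0.
have cf : continuous (fun t => expR (- (a * `|t|)) * (1 + cos (b * t))).
  move=> t; apply: cvgM.
    apply: (continuous_comp (f := fun t => - (a * `|t|)) (g := expR)).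
      apply: cvgN; apply: cvgM; first exact: cvg_cst.
      exact: norm_continuous.
    exact: continuous_expR.
  apply: cvgD; first exact: cvg_cst.
  apply: (continuous_comp (f := fun t => b * t) (g := cos)).
    exact: continuous_mull.
  exact: continuous_cos.
have f0 t : 0 <= expR (- (a * `|t|)) * (1 + cos (b * t)).
  by rewrite mulr_ge0 ?expR_ge0// -lerBlDl sub0r cos_geN1.
have even t : expR (- (a * `|t|)) * (1 + cos (b * t)) =
    expR (- (a * `|- t|)) * (1 + cos (b * - t)) by rewrite normrN mulrN cosN.
rewrite (ge0_symfun_integralT f0 cf even) -set_itvcy.
rewrite (@ge0_continuous_FTC2y _ _ (F a b) 0 0); first last.
- by move=> t; rewrite in_itv/= andbT => t0; have [_] := F_derive b t a0;
    rewrite derive1E => ->; rewrite gtr0_norm// mulNr.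
- by apply: cvg_at_right_filter; have [d _] := F_derive b 0 a0;
    apply: differentiable_continuous; exact/derivable1_diffP.
- by move=> t _; have [] := F_derive b t a0.
- exact: F_cvg.
- by apply: continuous_subspaceT.
- by move=> t _; rewrite mulr_ge0 ?expR_ge0// -lerBlDl sub0r cos_geN1.
rewrite /F !mulr0 expR0 sin0 cos0 -EFinB -EFinM; congr EFin.
have ab0 : a ^+ 2 + b ^+ 2 != 0.
  by rewrite gt_eqF// ltr_wpDr ?sqr_ge0// exprn_gt0.
by field; rewrite ab0 gt_eqF.
Qed.

End poisson1.

Section poisson_rV.
Context {R : realType}.
Local Notation leb := (@lebesgue_measure R).
Local Notation mu := (@lebesgue_rV R).

Lemma integral_oneDsqr : (\int[leb]_t ((oneDsqr t)^-1)%:E = (pi : R)%:E)%E.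
Proof.
have f0 (t : R) : 0 <= (oneDsqr t)^-1 by rewrite invr_ge0.
have even (t : R) : (oneDsqr t)^-1 = (oneDsqr (- t))^-1.
  by rewrite /oneDsqr sqrrN.
rewrite (ge0_symfun_integralT f0 continuous_oneDsqrV even) -set_itvcy.
by rewrite integral0y_oneDsqr -EFinM mulrC divfK.
Qed.

Lemma integralDZ d (T : measurableType d) (m : {measure set T -> \bar R})
    (f g : T -> R) (A B u v : R) :
  m.-integrable setT (EFin \o f) -> m.-integrable setT (EFin \o g) ->
  (\int[m]_x (f x)%:E = A%:E)%E -> (\int[m]_x (g x)%:E = B%:E)%E ->
  (\int[m]_x (u * f x + v * g x)%:E = (u * A + v * B)%:E)%E.
Proof.
move=> fi gi fA gB.
under eq_integral do rewrite EFinD !EFinM.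
rewrite integralD//; [|exact: (integrableZl measurableT u fi)
  |exact: (integrableZl measurableT v gi)].
by rewrite !integralZl// fA gB.
Qed.

(** Lebesgue measure is invariant under reflection, so the integral equals its own opposite. *)
Lemma integral_odd (f : R -> R) : measurable_fun setT f ->
  leb.-integrable setT (EFin \o f) -> (forall t, f (- t) = - f t) ->
  (\int[leb]_t (f t)%:E = 0)%E.
Proof.
move=> mf fi odd.
have mN : measurable_fun [set: measurableTypeR R]
  (-%R : measurableTypeR R -> measurableTypeR R) by exact: oppr_measurable.
have E : (\int[leb]_t (f t)%:E = \int[leb]_t (f (- t))%:E)%E.
  rewrite -(integral_pushforward mN (f := EFin \o f) (D := setT))//; last 2 first.
  - exact/measurable_EFinP.
  - rewrite preimage_setT.
    rewrite (_ : _ \o _ = fun t => (-1)%:E * (EFin \o f) t)%E; last first.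
      by apply/funext => t /=; rewrite odd -EFinM mulN1r.
    exact: integrableZl.
  by apply: eq_measure_integral => A mA _; rewrite [RHS]lebesgue_measureN.
have : (\int[leb]_t (f (- t))%:E = - \int[leb]_t (f t)%:E)%E.
  by under eq_integral do rewrite odd EFinN; rewrite integralN// integrable_add_def.
rewrite -E.
have : (\int[leb]_t (f t)%:E)%E \is a fin_num by exact: integrable_fin_num.
case: (\int[leb]_t (f t)%:E)%E => //= r _ [h].
by congr EFin; lra.
Qed.

Lemma integrable_bound d (T : measurableType d) (m : {measure set T -> \bar R})
    (f g : T -> R) (C : R) :
  measurable_fun setT f -> m.-integrable setT (EFin \o g) ->
  (forall x, `|f x| <= C * g x) -> m.-integrable setT (EFin \o f).
Proof.
move=> mf gi fg; apply: (le_integrable _ _ _ (integrableZl measurableT C gi)) => //.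
  exact/measurable_EFinP.
by move=> x _ /=; rewrite lee_fin (le_trans (fg x))// ler_norm.
Qed.

Lemma integral_rVS n (f : 'rV[R]_n.+1 -> \bar R) :
  (mu n.+1).-integrable setT f ->
  (\int[mu n.+1]_x f x = \int[leb]_t \int[mu n]_x f (rV_cons (t, x)))%E.
Proof.
move=> /integrableP[mf fi].
have mfc : measurable_fun setT (f \o @rV_cons R n).
  by apply: measurableT_comp => //; exact: measurable_rV_cons.
have fci : (leb \x mu n)%E.-integrable setT (f \o @rV_cons R n).
  apply/integrableP; split => //.
  have mafc : measurable_fun setT (fun p => `|f (@rV_cons R n p)|%E).
    exact: measurableT_comp.
  rewrite [ltLHS](fubini_tonelli1 (m1 := leb) (m2 := mu n) _ mafc)//=.
  rewrite /fubini_F -(ge0_integral_rVS (f := abse \o f))//.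
    exact: measurableT_comp.
  by move=> x; exact: abse_ge0.
rewrite [RHS](integral12_prod_meas1 fci).
by rewrite (integral_pushforward (@measurable_rV_cons R n)).
Qed.

Definition expw k (a : R) (z : 'rV[R]_k) : R :=
  \prod_(j < k) expR (- (a * `|z ord0 j|)).

Lemma expw_ge0 k a (z : 'rV[R]_k) : 0 <= expw a z.
Proof. by apply: prodr_ge0 => j _; exact: expR_ge0. Qed.

Lemma expw_le1 k a (z : 'rV[R]_k) : 0 <= a -> expw a z <= 1.
Proof.
move=> a0; apply: prodr_ile1 => j _; rewrite expR_ge0/= -[leRHS]expR0 ler_expR.
by rewrite oppr_le0 mulr_ge0.
Qed.

Lemma measurable_expw k a : measurable_fun setT (@expw k a).
Proof.
apply: measurable_prod => j _; apply: measurableT_comp => //.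
apply: measurable_funN; apply: measurable_funM => //.
by apply: measurableT_comp => //; exact: measurable_coord.
Qed.

Section one_dim.
Variables a b : R.
Hypothesis a0 : 0 < a.

Let mE : measurable_fun setT (fun t : R => expR (- (a * `|t|))).
Proof.
apply: measurableT_comp => //; apply: measurable_funN.
by apply: measurable_funM => //; exact: normr_measurable.
Qed.

(** The case b = 0 of [integral_expR_1cos], where 1 + cos is the constant 2. *)
Lemma integral_expR_norm : (\int[leb]_t (expR (- (a * `|t|)))%:E = (2 / a)%:E)%E.
Proof.
have := integral_expR_1cos 0 a0.
under eq_integral do rewrite mul0r cos0 mulrC EFinM.
rewrite ge0_integralZl//=; last exact/measurable_EFinP.
rewrite expr0n/= addr0 expr2 -mulf_div mulfV ?gt_eqF// mulr1.
case: (\int[leb]_t _)%E => [r||].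
- by move=> [h]; congr EFin; apply: (mulfI (_ : 2 != 0)); [|rewrite h]; lra.
- by rewrite mulry gtr0_sg// mul1e.
- by rewrite mulrNy gtr0_sg// mul1e.
Qed.

Lemma integrable_expR_norm :
  leb.-integrable setT (fun t : R => (expR (- (a * `|t|)))%:E).
Proof.
apply/integrableP; split; first exact/measurable_EFinP.
under eq_integral do rewrite /= ger0_norm ?expR_ge0//.
by rewrite integral_expR_norm ltry.
Qed.

Lemma integrable_expR_cos :
  leb.-integrable setT (EFin \o (fun t : R => expR (- (a * `|t|)) * cos (b * t))).
Proof.
apply: (@integrable_bound _ _ leb _ (fun t : R => expR (- (a * `|t|))) 1).
- apply: measurable_funM => //.
  apply: (measurableT_comp (continuous_measurable_fun (@continuous_cos R))).
  exact: mulrl_measurable.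
- exact: integrable_expR_norm.
- move=> t; rewrite mul1r normrM ger0_norm ?expR_ge0// ler_piMr ?expR_ge0//.
  by rewrite ler_norml cos_geN1 cos_le1.
Qed.

Lemma integrable_expR_sin :
  leb.-integrable setT (EFin \o (fun t : R => expR (- (a * `|t|)) * sin (b * t))).
Proof.
apply: (@integrable_bound _ _ leb _ (fun t : R => expR (- (a * `|t|))) 1).
- apply: measurable_funM => //.
  apply: (measurableT_comp (continuous_measurable_fun (@continuous_sin R))).
  exact: mulrl_measurable.
- exact: integrable_expR_norm.
- move=> t; rewrite mul1r normrM ger0_norm ?expR_ge0// ler_piMr ?expR_ge0//.
  by rewrite ler_norml sin_geN1 sin_le1.
Qed.

(** The 1 added to the cosine in [integral_expR_1cos] is removed by subtracting
    [integral_expR_norm]. *)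
Lemma integral_expR_cos :
  (\int[leb]_t (expR (- (a * `|t|)) * cos (b * t))%:E =
   (2 * a / (a ^+ 2 + b ^+ 2))%:E)%E.
Proof.
have := integral_expR_1cos b a0.
under eq_integral do rewrite mulrDr mulr1 EFinD.
rewrite integralD//; [|exact: integrable_expR_norm|exact: integrable_expR_cos].
rewrite integral_expR_norm.
have := integrable_fin_num measurableT integrable_expR_cos.
rewrite /comp; case: (\int[leb]_t _)%E => // r _ [] h; congr EFin; lra.
Qed.

Lemma integral_expR_sin :
  (\int[leb]_t (expR (- (a * `|t|)) * sin (b * t))%:E = 0)%E.
Proof.
apply: integral_odd.
- apply: measurable_funM => //.
  apply: (measurableT_comp (continuous_measurable_fun (@continuous_sin R))).
  exact: mulrl_measurable.
- exact: integrable_expR_sin.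
- by move=> t; rewrite normrN mulrN sinN mulrN.
Qed.
End one_dim.

End poisson_rV.

(** * The Fourier integral of the damping factor in several variables, and the weight [decw] *)

Section poisson_kernel_rV.
Context {R : realType}.
Local Notation leb := (@lebesgue_measure R).
Local Notation mu := (@lebesgue_rV R).

Lemma dotrVE n (x y : 'rV[R]_n) : dotrV x y = \sum_j x ord0 j * y ord0 j.
Proof. by rewrite /dotrV !mxE; apply: eq_bigr => j _; rewrite !mxE. Qed.

Lemma measurable_dotrV n (c : 'rV[R]_n) :
  measurable_fun setT (fun x : 'rV[R]_n => dotrV x c).
Proof.
under eq_fun do rewrite dotrVE.
apply: measurable_sum => j; apply: measurable_funM => //.
exact: measurable_coord.
Qed.

Lemma measurable_sin_comp d (T : measurableType d) (f : T -> R) :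
  measurable_fun setT f -> measurable_fun setT (sin \o f).
Proof.
move=> mf; apply: measurableT_comp => //.
exact: (continuous_measurable_fun (@continuous_sin R)).
Qed.

Lemma measurable_cos_comp d (T : measurableType d) (f : T -> R) :
  measurable_fun setT f -> measurable_fun setT (cos \o f).
Proof.
move=> mf; apply: measurableT_comp => //.
exact: (continuous_measurable_fun (@continuous_cos R)).
Qed.

Lemma norm_cos_le1 (x : R) : `|cos x| <= 1.
Proof. by rewrite ler_norml cos_geN1 cos_le1. Qed.

Lemma norm_sin_le1 (x : R) : `|sin x| <= 1.
Proof. by rewrite ler_norml sin_geN1 sin_le1. Qed.

Lemma integrable_expw k (a : R) : 0 < a ->
  (mu k).-integrable setT (EFin \o @expw R k a).
Proof.
move=> a0; apply/integrableP; split.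
  by apply/measurable_EFinP; exact: measurable_expw.
under eq_integral do rewrite /= ger0_norm ?expw_ge0//.
rewrite (@ge0_integral_rV_prod _ _ (fun t => expR (- (a * `|t|))) (2 / a))//.
- by rewrite ltry.
- apply: measurableT_comp => //; apply: measurable_funN.
  by apply: measurable_funM => //; exact: normr_measurable.
- exact: integral_expR_norm.
Qed.

Lemma integrable_expwM k (a : R) (h : 'rV[R]_k -> R) : 0 < a ->
  measurable_fun setT h -> (forall z, `|h z| <= 1) ->
  (mu k).-integrable setT (EFin \o (fun z => expw a z * h z)).
Proof.
move=> a0 mh h1; apply: (@integrable_bound _ _ _ (mu k) _ (expw a) 1).
- by apply: measurable_funM => //; exact: measurable_expw.
- exact: integrable_expw.
- by move=> z; rewrite mul1r normrM ger0_norm ?expw_ge0// ler_piMr ?expw_ge0.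
Qed.

(** Both integrals go through one induction on [k]: the addition formulas express the cosine and the
    sine of the full phase through those of the first coordinate and of the remaining ones. Every
    term containing a sine integral vanishes by oddness, so only the product of cosine integrals
    survives. *)
Lemma integral_expw_cos_sin k (a : R) (c : 'rV[R]_k) : 0 < a ->
  (\int[mu k]_z (expw a z * cos (dotrV z c))%:E =
     (\prod_(j < k) (2 * a / (a ^+ 2 + c ord0 j ^+ 2)))%:E /\
   \int[mu k]_z (expw a z * sin (dotrV z c))%:E = 0)%E.
Proof.
move=> a0.
have icos l (d : 'rV[R]_l) : (mu l).-integrable setT
    (EFin \o (fun z => expw a z * cos (dotrV z d))).
  apply: integrable_expwM => // [|z]; last exact: norm_cos_le1.
  by apply: measurable_cos_comp; exact: measurable_dotrV.
have isin l (d : 'rV[R]_l) : (mu l).-integrable setT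
    (EFin \o (fun z => expw a z * sin (dotrV z d))).
  apply: integrable_expwM => // [|z]; last exact: norm_sin_le1.
  by apply: measurable_sin_comp; exact: measurable_dotrV.
elim: k c => [|k ih] c.
  rewrite !integral_dirac//=; [|exact: measurable_int (isin _ c)
    |exact: measurable_int (icos _ c)].
  by rewrite !diracT !mul1e /expw !big_ord0 dotrVE big_ord0 sin0 cos0 mulr0 mulr1.
pose c' : 'rV[R]_k := \row_j c ord0 (lift ord0 j).
have [ihc ihs] := ih c'.
have E t (z : 'rV[R]_k) : expw a (rV_cons (t, z)) = expR (- (a * `|t|)) * expw a z.
  rewrite /expw big_ord_recl rV_cons_ord0; congr (_ * _).
  by apply: eq_bigr => j _; rewrite rV_cons_lift.
have D t (z : 'rV[R]_k) : dotrV (rV_cons (t, z)) c = c ord0 ord0 * t + dotrV z c'.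
  rewrite !dotrVE big_ord_recl rV_cons_ord0 mulrC; congr (_ + _).
  by apply: eq_bigr => j _; rewrite rV_cons_lift mxE.
set b := c ord0 ord0 in D *.
set C := \prod_(j < k) _ in ihc.
have -> : \prod_(j < k.+1) (2 * a / (a ^+ 2 + c ord0 j ^+ 2)) =
    (2 * a / (a ^+ 2 + b ^+ 2)) * C.
  by rewrite big_ord_recl; congr (_ * _); apply: eq_bigr => j _; rewrite mxE.
split.
  rewrite integral_rVS; last exact: icos.
  (* A sine term with coefficient 0 is added so that [integralDZ] evaluates the integral over the
     first coordinate. *)
  transitivity (\int[leb]_t (C * (expR (- (a * `|t|)) * cos (b * t)) +
                             0 * (expR (- (a * `|t|)) * sin (b * t)))%:E)%E.
    apply: eq_integral => t _; rewrite mul0r addr0.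
    have := integralDZ (expR (- (a * `|t|)) * cos (b * t))
      (- (expR (- (a * `|t|)) * sin (b * t))) (icos _ c') (isin _ c') ihc ihs.
    rewrite mulr0 addr0 (mulrC C) => <-; apply: eq_integral => z _; congr EFin.
    by rewrite E D cosD; ring.
  rewrite (integralDZ _ _ (integrable_expR_cos b a0) (integrable_expR_sin b a0)
    (integral_expR_cos b a0) (integral_expR_sin b a0)).
  by congr EFin; ring.
rewrite integral_rVS; last exact: isin.
transitivity (\int[leb]_t (0 * (expR (- (a * `|t|)) * cos (b * t)) +
                           C * (expR (- (a * `|t|)) * sin (b * t)))%:E)%E.
  apply: eq_integral => t _; rewrite mul0r add0r.
  have := integralDZ (expR (- (a * `|t|)) * sin (b * t))
    (expR (- (a * `|t|)) * cos (b * t)) (icos _ c') (isin _ c') ihc ihs.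
  rewrite mulr0 addr0 (mulrC C) => <-; apply: eq_integral => z _; congr EFin.
  by rewrite E D sinD; ring.
rewrite (integralDZ _ _ (integrable_expR_cos b a0) (integrable_expR_sin b a0)
  (integral_expR_cos b a0) (integral_expR_sin b a0)).
by congr EFin; ring.
Qed.

(** This weight has two roles: an integrable majorant, and the profile left by the Poisson kernel
    after dilation. The product form makes it factor along [row_mx]. *)
Definition decw n (y : 'rV[R]_n) : R := \prod_(j < n) (oneDsqr (y ord0 j))^-1.

Lemma decw_ge0 n (y : 'rV[R]_n) : 0 <= decw y.
Proof. by apply: prodr_ge0 => j _; rewrite invr_ge0. Qed.

Lemma decw_le1 n (y : 'rV[R]_n) : decw y <= 1.
Proof.
apply: prodr_ile1 => j _; rewrite invr_ge0/= oneDsqrV_le1 andbT.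
by rewrite (le_trans _ (oneDsqr_ge1 _)).
Qed.

Lemma measurable_decw n : measurable_fun setT (@decw n).
Proof.
apply: measurable_prod => j _.
apply: (measurableT_comp (continuous_measurable_fun continuous_oneDsqrV)).
exact: measurable_coord.
Qed.

Lemma integral_decw n : (\int[mu n]_y (decw y)%:E = (pi ^+ n)%:E)%E.
Proof.
rewrite (@ge0_integral_rV_prod _ _ (fun t => (oneDsqr t)^-1) (pi))//.
- exact: (continuous_measurable_fun continuous_oneDsqrV).
- exact: integral_oneDsqr.
Qed.

Lemma integrable_decw n : (mu n).-integrable setT (EFin \o @decw n).
Proof.
apply/integrableP; split; first by apply/measurable_EFinP; exact: measurable_decw.
under eq_integral do rewrite /= ger0_norm ?decw_ge0//.
by rewrite integral_decw ltry.
Qed.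

Lemma decw_row_mx m k (y : 'rV[R]_m) (z : 'rV[R]_k) :
  decw (row_mx y z) = decw y * decw z.
Proof.
rewrite /decw big_split_ord/=; congr (_ * _); apply: eq_bigr => j _.
  by rewrite row_mxEl.
by rewrite row_mxEr.
Qed.

End poisson_kernel_rV.

(** * The inversion inequality *)

Section inversion.
Context {R : realType}.
Local Notation leb := (@lebesgue_measure R).
Local Notation mu := (@lebesgue_rV R).

(** The positive part of [f] lies below [g], and the integral of [f] is at most that of its positive
    part. This serves to compare a signed integrand with a majorant whose integral may be
    infinite. *)
Lemma integral_le_ge0 d (T : measurableType d) (m : {measure set T -> \bar R})
    (f g : T -> \bar R) :
  measurable_fun setT f -> measurable_fun setT g ->
  (forall x, 0 <= g x)%E -> (forall x, f x <= g x)%E ->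
  (\int[m]_x f x <= \int[m]_x g x)%E.
Proof.
move=> mf mg g0 fg; apply: (@le_trans _ _ (\int[m]_x f^\+ x)%E).
  by rewrite integralE -[leRHS]sube0 leeB// integral_ge0.
apply: ge0_le_integral => //; first exact: measurable_funepos.
by move=> x _; rewrite funeposE ge_max fg g0.
Qed.

Section last_coordinates.
Variables m k : nat.

(** As [c] tends to 0 this dilation collapses the space onto the subspace of vanishing last
    coordinates, which is how the restriction appears. *)
Definition scale_r (c : R) (y : 'rV[R]_(m + k)) : 'rV[R]_(m + k) :=
  row_mx (lsubmx y) (c *: rsubmx y).

Lemma scale_r_row_mx c y z : scale_r c (row_mx y z) = row_mx y (c *: z).
Proof. by rewrite /scale_r row_mxKl row_mxKr. Qed.

Lemma measurable_row_mxr (y : 'rV[R]_m) :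
  measurable_fun setT (fun z : 'rV[R]_k => row_mx y z).
Proof.
apply: measurable_fun_coordP => i; case: (split_ordP i) => j ->.
  by under eq_fun do rewrite row_mxEl; exact: measurable_cst.
by under eq_fun do rewrite row_mxEr; exact: measurable_coord.
Qed.

Lemma measurable_row_mxl (z : 'rV[R]_k) :
  measurable_fun setT (fun y : 'rV[R]_m => row_mx y z).
Proof.
apply: measurable_fun_coordP => i; case: (split_ordP i) => j ->.
  by under eq_fun do rewrite row_mxEl; exact: measurable_coord.
by under eq_fun do rewrite row_mxEr; exact: measurable_cst.
Qed.

Lemma measurable_lsubmx :
  measurable_fun setT (fun y : 'rV[R]_(m + k) => lsubmx y).
Proof.
apply: measurable_fun_coordP => i.
rewrite (_ : (fun _ => _) = fun y : 'rV[R]_(m + k) => y ord0 (lshift k i)).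
  exact: measurable_coord.
by apply/funext => y; rewrite mxE.
Qed.

Lemma measurable_rsubmx :
  measurable_fun setT (fun y : 'rV[R]_(m + k) => rsubmx y).
Proof.
apply: measurable_fun_coordP => i.
rewrite (_ : (fun _ => _) = fun y : 'rV[R]_(m + k) => y ord0 (rshift m i)).
  exact: measurable_coord.
by apply/funext => y; rewrite mxE.
Qed.

Lemma measurable_scale_r c : measurable_fun setT (scale_r c).
Proof.
rewrite (_ : scale_r c = (fun p => row_mx p.1 p.2) \o
  (fun y : 'rV[R]_(m + k) => (lsubmx y, c *: rsubmx y)))//.
apply: measurableT_comp; first exact: measurable_row_mx.
apply/measurable_fun_pairP; split; first exact: measurable_lsubmx.
by apply: (measurableT_comp (measurable_scale_rV c)); exact: measurable_rsubmx.
Qed.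

Lemma ge0_integral_scale_r c (f : 'rV[R]_(m + k) -> \bar R) : 0 < c ->
  measurable_fun setT f -> (forall x, 0 <= f x)%E ->
  ((c ^+ k)%:E * \int[mu (m + k)]_y f (scale_r c y) =
   \int[mu (m + k)]_y f y)%E.
Proof.
move=> c0 mf f0.
have mfs := measurableT_comp mf (measurable_scale_r c).
rewrite ge0_integral_row_mx// [RHS]ge0_integral_row_mx//.
rewrite -ge0_integralZl//.
- apply: eq_integral => y _.
  rewrite -[RHS](ge0_integral_rV_scale c0)//.
    congr (_ * _)%E; apply: eq_integral => z _.
    by rewrite /= scale_r_row_mx.
  apply: measurableT_comp => //.
  exact: measurable_row_mxr.
- apply: (measurable_fun_fubini_tonelli_F (m2 := mu k)
    (fun p => f (scale_r c (row_mx p.1 p.2)))) => //.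
  exact: (measurable_comp_row_mx mfs).
- by move=> y _; exact: integral_ge0.
- by rewrite lee_fin exprn_ge0// ltW.
Qed.

Lemma integrable_scale_r c (f : 'rV[R]_(m + k) -> \bar R) : 0 < c ->
  (mu (m + k)).-integrable setT f ->
  (mu (m + k)).-integrable setT (f \o scale_r c).
Proof.
move=> c0 fi; have mf := measurable_int _ fi.
apply/integrableP; split.
  by apply: (measurableT_comp mf); exact: measurable_scale_r.
have ck0 : 0 < c ^+ k by rewrite exprn_gt0.
rewrite -(@lte_pmul2l _ (c ^+ k)%:E)// mulry gtr0_sg// mul1e.
rewrite (ge0_integral_scale_r c0 (f := abse \o f))//.
- by move/integrableP : fi => [].
- exact: measurableT_comp.
- by move=> y; exact: abse_ge0.
Qed.

Lemma integral_scale_r c (f : 'rV[R]_(m + k) -> \bar R) : 0 < c ->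
  (mu (m + k)).-integrable setT f ->
  ((c ^+ k)%:E * \int[mu (m + k)]_y f (scale_r c y) =
   \int[mu (m + k)]_y f y)%E.
Proof.
move=> c0 fi; have mf := measurable_int _ fi.
have fsi := integrable_scale_r c0 fi.
rewrite integralE muleBr//; last exact: (integrable_add_def measurableT fsi).
rewrite [RHS]integralE; congr (_ - _)%E.
  rewrite -[RHS](ge0_integral_scale_r c0)//; last exact: measurable_funepos.
  by congr (_ * _)%E; apply: eq_integral => y _; rewrite !funeposE.
rewrite -[RHS](ge0_integral_scale_r c0)//; last exact: measurable_funeneg.
by congr (_ * _)%E; apply: eq_integral => y _; rewrite !funenegE.
Qed.

End last_coordinates.

End inversion.

(** * Damped Fourier inversion in the last coordinates *)

Section inversion_inequality.
Context {R : realType}.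
Local Notation leb := (@lebesgue_measure R).
Local Notation mu := (@lebesgue_rV R).

Definition poisson_kernel k (a : R) (u : 'rV[R]_k) : R :=
  \prod_(j < k) (2 * a / (a ^+ 2 + u ord0 j ^+ 2)).

Lemma measurable_poisson_kernel k a : 0 < a ->
  measurable_fun setT (@poisson_kernel k a).
Proof.
move=> a0; apply: measurable_prod => j _; apply: measurable_funM => //.
(* Writing a^2 + t^2 = a^2 (1 + (t/a)^2) reduces measurability to continuity of the inverse of
   [oneDsqr]. *)
pose h (t : R) := (a ^+ 2)^-1 * (oneDsqr (a^-1 * t))^-1.
have mh : measurable_fun setT h.
  apply: measurable_funM => //.
  apply: (measurableT_comp (continuous_measurable_fun (@continuous_oneDsqrV R))).
  exact: mulrl_measurable.
rewrite (_ : (fun _ => _) = h \o (fun u : 'rV[R]_k => u ord0 j)).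
  exact: (measurableT_comp mh (measurable_coord j)).
apply/funext => u; rewrite /h/= /oneDsqr.
have au0 : a ^+ 2 + u ord0 j ^+ 2 != 0.
  by rewrite gt_eqF// ltr_wpDr ?sqr_ge0// exprn_gt0.
by field; rewrite au0 gt_eqF.
Qed.

Lemma poisson_kernel_ge0 k a (u : 'rV[R]_k) : 0 < a -> 0 <= poisson_kernel a u.
Proof.
move=> a0; apply: prodr_ge0 => j _; rewrite divr_ge0 ?mulr_ge0 ?(ltW a0)//.
by rewrite addr_ge0 ?sqr_ge0.
Qed.

Lemma poisson_kernel_le k a (u : 'rV[R]_k) : 0 < a ->
  poisson_kernel a u <= (2 / a) ^+ k.
Proof.
move=> a0; rewrite /poisson_kernel -[k in leRHS]card_ord -prodr_const.
apply: ler_prod => j _; have a20 : 0 < a ^+ 2 by rewrite exprn_gt0.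
have au0 : 0 < a ^+ 2 + u ord0 j ^+ 2 by rewrite ltr_wpDr ?sqr_ge0.
rewrite divr_ge0 ?mulr_ge0 ?(ltW a0) ?(ltW au0)//=.
rewrite ler_pdivrMr// mulrAC ler_pdivlMr// -mulrA ler_pM2l// -expr2.
by rewrite lerDl sqr_ge0.
Qed.

(** One factor is e (2 e lam) / (e^2 lam^2 (1 + z_j^2)) = (2 / lam) / (1 + z_j^2): the Jacobian of
    the dilation cancels [e] entirely. *)
Lemma poisson_kernel_scale k (e lam : R) (z : 'rV[R]_k) : 0 < e -> 0 < lam ->
  e ^+ k * poisson_kernel (e * lam) (lam *: (e *: z)) = (2 / lam) ^+ k * decw z.
Proof.
move=> e0 lam0; rewrite /poisson_kernel /decw.
rewrite -[k in e ^+ k]card_ord -[k in (2 / lam) ^+ k]card_ord -!prodr_const.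
rewrite -!big_split/=; apply: eq_bigr => j _; rewrite !mxE /oneDsqr.
have h : 1 + z ord0 j ^+ 2 != 0 by rewrite gt_eqF// ltr_pwDl ?sqr_ge0.
have h' : (e * lam) ^+ 2 + (lam * (e * z ord0 j)) ^+ 2 != 0.
  rewrite (_ : _ + _ = (e * lam) ^+ 2 * (1 + z ord0 j ^+ 2)); last by ring.
  by rewrite mulf_neq0// sqrf_eq0 mulf_neq0 ?gt_eqF.
by field; rewrite h h' gt_eqF.
Qed.

Lemma integrable_prodM d1 d2 (T1 : measurableType d1) (T2 : measurableType d2)
    (m1 : {sigma_finite_measure set T1 -> \bar R})
    (m2 : {sigma_finite_measure set T2 -> \bar R}) (f : T1 -> R) (g : T2 -> R) :
  m1.-integrable setT (EFin \o f) -> m2.-integrable setT (EFin \o g) ->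
  (m1 \x m2)%E.-integrable setT (fun p => (f p.1 * g p.2)%:E).
Proof.
move=> fi gi; have /measurable_EFinP mf := measurable_int _ fi.
have /measurable_EFinP mg := measurable_int _ gi.
apply/integrable12ltyP.
  apply/measurable_EFinP; apply: measurable_funM.
    by apply: measurableT_comp => //; exact: measurable_fst.
  by apply: measurableT_comp => //; exact: measurable_snd.
have /integrableP[_ foo] := fi; have /integrableP[_ goo] := gi.
have -> : (\int[m1]_x \int[m2]_y `|(f x * g y)%:E| =
    \int[m1]_x (`|f x|%:E * \int[m2]_y `|g y|%:E))%E.
  apply: eq_integral => x _; rewrite -ge0_integralZl//.
    by apply: eq_integral => y _; rewrite /= normrM EFinM.
  by apply/measurable_EFinP; exact: measurableT_comp.
rewrite ge0_integralZr//.
- rewrite lte_mul_pinfty//; first exact: integral_ge0.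
  by rewrite ge0_fin_numE// integral_ge0.
- by apply/measurable_EFinP; exact: measurableT_comp.
- exact: integral_ge0.
Qed.

Section statement.
Variables (m k : nat) (lam C : R) (P Q : 'rV[R]_(m + k) -> R).
Variable T : 'rV[R]_k -> \bar R.
Hypothesis lam0 : 0 < lam.
Hypotheses (mP : measurable_fun setT P) (mQ : measurable_fun setT Q).
Hypothesis Pw : forall y, `|P y| <= C * decw y.
Hypothesis Qw : forall y, `|Q y| <= C * decw y.
Hypotheses (mT : measurable_fun setT T) (T0 : forall z, (0 <= T z)%E).
(** The real part of exp(-i lam z.y'') (P + i Q)(y), where y'' denotes the last [k] coordinates of
    [y]. *)
Let osc (z : 'rV[R]_k) (y : 'rV[R]_(m + k)) : R :=
  cos (dotrV z (lam *: rsubmx y)) * P y + sin (dotrV z (lam *: rsubmx y)) * Q y.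
Hypothesis PQT : forall z, (\int[mu (m + k)]_y (osc z y)%:E <= T z)%E.

Let C0 : 0 <= C.
Proof.
have := le_trans (normr_ge0 _) (Pw 0); rewrite pmulr_lge0//.
by apply: prodr_gt0 => j _; rewrite mxE invr_gt0 (lt_le_trans _ (oneDsqr_ge1 _)).
Qed.

Let osc_bound z y : `|osc z y| <= 2 * C * decw y.
Proof.
rewrite (le_trans (ler_normD _ _))// !normrM -mulrA [2]mulr2n mulrDl mul1r lerD//.
  by rewrite (le_trans _ (Pw y))// ler_piMl ?norm_cos_le1.
by rewrite (le_trans _ (Qw y))// ler_piMl ?norm_sin_le1.
Qed.

Let mosc : measurable_fun setT
  (fun p : 'rV[R]_k * 'rV[R]_(m + k) => osc p.1 p.2).
Proof.
have md : measurable_fun setT (fun p : 'rV[R]_k * 'rV[R]_(m + k) =>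
    dotrV p.1 (lam *: rsubmx p.2)).
  under eq_fun do rewrite dotrVE.
  apply: measurable_sum => j; under eq_fun do rewrite !mxE.
  apply: measurable_funM.
    by apply: (measurableT_comp (measurable_coord j)); exact: measurable_fst.
  apply: measurable_funM => //.
  by apply: (measurableT_comp (measurable_coord (rshift m j))); exact: measurable_snd.
apply: measurable_funD; apply: measurable_funM.
- exact: measurable_cos_comp.
- by apply: measurableT_comp => //; exact: measurable_snd.
- exact: measurable_sin_comp.
- by apply: measurableT_comp => //; exact: measurable_snd.
Qed.

(** Integrating [expw a z * osc z y] over [z] produces the kernel times [P y], the sine part
    multiplying [Q y] being 0. The majorant [expw] times [decw] is integrable on the product, so
    Fubini allows the integral over [y] to be taken first, where the bound by [T] applies. *)
Lemma integral_poisson_kernel_le a : 0 < a ->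
  (\int[mu (m + k)]_y (poisson_kernel a (lam *: rsubmx y) * P y)%:E
     <= \int[mu k]_z T z)%E.
Proof.
move=> a0.
pose f0 (p : 'rV[R]_k * 'rV[R]_(m + k)) : R := expw a p.1 * osc p.1 p.2.
pose f := EFin \o f0.
have mf : measurable_fun setT f.
  apply/measurable_EFinP; apply: measurable_funM => //.
  by apply: measurableT_comp; [exact: measurable_expw|exact: measurable_fst].
have fi : (mu k \x mu (m + k))%E.-integrable setT f.
  have ewi := integrable_prodM (integrable_expw k a0) (@integrable_decw R (m + k)).
  have mf0 : measurable_fun setT f0 by exact/measurable_EFinP.
  apply: (@integrable_bound _ _ _ (mu k \x mu (m + k))%E f0 _ (2 * C) mf0 ewi).
  move=> p; rewrite normrM ger0_norm ?expw_ge0// mulrCA.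
  by rewrite ler_wpM2l ?expw_ge0// osc_bound.
have -> : (\int[mu (m + k)]_y (poisson_kernel a (lam *: rsubmx y) * P y)%:E =
    \int[mu (m + k)]_y \int[mu k]_z f (z, y))%E.
  apply: eq_integral => y _; rewrite /f/f0/=.
  have [Ec Es] := integral_expw_cos_sin (lam *: rsubmx y) a0.
  have ic : (mu k).-integrable setT
      (EFin \o (fun z => expw a z * cos (dotrV z (lam *: rsubmx y)))).
    apply: integrable_expwM => // [|z]; last exact: norm_cos_le1.
    by apply: measurable_cos_comp; exact: measurable_dotrV.
  have is_ : (mu k).-integrable setT
      (EFin \o (fun z => expw a z * sin (dotrV z (lam *: rsubmx y)))).
    apply: integrable_expwM => // [|z]; last exact: norm_sin_le1.
    by apply: measurable_sin_comp; exact: measurable_dotrV.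
  have := integralDZ (P y) (Q y) ic is_ Ec Es.
  rewrite mulr0 addr0 mulrC => <-; apply: eq_integral => z _.
  by rewrite /osc; congr EFin; ring.
rewrite -(Fubini fi); apply: integral_le_ge0 => //.
  exact: (measurable_fubini_F fi).
move=> z; rewrite /f/f0/=.
under eq_integral do rewrite EFinM.
have oi : (mu (m + k)).-integrable setT (fun y => (osc z y)%:E).
  apply: integrable_bound (@integrable_decw R _) (osc_bound z).
  by apply: (measurableT_comp mosc (g := fun y => (z, y))); exact: measurable_pair1.
rewrite integralZl//.
apply: (@le_trans _ _ ((expw a z)%:E * T z)%E).
  by rewrite lee_wpmul2l ?lee_fin ?expw_ge0.
(* Since [T] is nonnegative and the damping is at most 1, the damping can now be dropped, uniformly
   in [a]. *)
by rewrite gee_pMl ?lee_fin ?expw_le1 ?expw_ge0 ?(ltW a0).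
Qed.

(** The kernel bound is applied with a = e lam and e = 1/(n+1), then the last coordinates are
    dilated by [e]. The kernel becomes (2 / lam)^k [decw] and [P] is evaluated at (y', e y''), which
    tends to (y', 0). Integrating [decw] over y'' contributes the missing pi^k. *)
Lemma inversion_inequality (cP : continuous P) :
  (((2 * pi / lam) ^+ k)%:E * \int[mu m]_y (P (row_mx y 0))%:E
     <= \int[mu k]_z T z)%E.
Proof.
pose e (n : nat) : R := n.+1%:R^-1.
have e0 n : 0 < e n by rewrite invr_gt0.
pose g (n : nat) y : \bar R :=
  ((2 / lam) ^+ k * decw (rsubmx y) * P (scale_r (e n) y))%:E.
pose g_ y : \bar R := ((2 / lam) ^+ k * decw (rsubmx y) * P (scale_r 0 y))%:E.
have mPs c : measurable_fun setT (fun y => P (scale_r c y)).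
  by apply: measurableT_comp => //; exact: measurable_scale_r.
have mw : measurable_fun setT (fun y : 'rV[R]_(m + k) => decw (rsubmx y)).
  by apply: measurableT_comp; [exact: measurable_decw|exact: measurable_rsubmx].
have mg c : measurable_fun setT
    (fun y => (2 / lam) ^+ k * decw (rsubmx y) * P (scale_r c y)).
  by apply: measurable_funM => //; exact: measurable_funM.
(* The majorant must not depend on [c]: decay in the last coordinates comes from the kernel alone,
   while [P] at the dilated point supplies only [decw] of the first ones. *)
have g_le c y : `|(2 / lam) ^+ k * decw (rsubmx y) * P (scale_r c y)| <=
    (2 / lam) ^+ k * C * decw y.
  have lk0 : 0 <= (2 / lam) ^+ k by rewrite exprn_ge0// divr_ge0// ltW.
  rewrite !normrM (ger0_norm lk0) (ger0_norm (decw_ge0 _)).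
  rewrite -[in leRHS](hsubmxK y) decw_row_mx -!mulrA ler_wpM2l//.
  rewrite mulrA mulrC ler_wpM2r ?decw_ge0// (le_trans (Pw _))//.
  by rewrite ler_wpM2l// /scale_r decw_row_mx ler_piMr ?decw_ge0 ?decw_le1.
have gi c : (mu (m + k)).-integrable setT
    (fun y => ((2 / lam) ^+ k * decw (rsubmx y) * P (scale_r c y))%:E).
  exact: integrable_bound (mg c) (@integrable_decw R _) (g_le c).
have gE n : (\int[mu (m + k)]_y g n y =
    \int[mu (m + k)]_y (poisson_kernel (e n * lam) (lam *: rsubmx y) * P y)%:E)%E.
  have en := e0 n; have el0 : 0 < e n * lam by rewrite mulr_gt0.
  have mK : measurable_fun setT (fun y : 'rV[R]_(m + k) =>
      poisson_kernel (e n * lam) (lam *: rsubmx y)).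
    apply: (measurableT_comp (measurable_poisson_kernel el0)).
    by apply: (measurableT_comp (measurable_scale_rV lam)); exact: measurable_rsubmx.
  have Kb y : `|poisson_kernel (e n * lam) (lam *: rsubmx y) * P y| <=
      (2 / (e n * lam)) ^+ k * C * decw y.
    rewrite normrM -mulrA ler_pM// ger0_norm ?poisson_kernel_ge0//.
    exact: poisson_kernel_le.
  have Ki := integrable_bound (measurable_funM mK mP) (@integrable_decw R _) Kb.
  rewrite -[RHS](integral_scale_r en); last exact: Ki.
  rewrite -integralZl//; last exact: integrable_scale_r en Ki.
  apply: eq_integral => y _; rewrite /g -EFinM; congr EFin.
  by rewrite /scale_r row_mxKr mulrA poisson_kernel_scale.
have cvg_g : (\int[mu (m + k)]_y g n y @[n --> \oo] --> \int[mu (m + k)]_y g_ y)%E.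
  apply: (@dominated_cvg _ _ _ _ _ measurableT _ _
    (fun y => ((2 / lam) ^+ k * C * decw y)%:E)) => //.
  - by move=> n; apply/measurable_EFinP.
  - move=> y _; apply: cvg_EFin; first exact: nearW.
    apply: cvgM; first exact: cvg_cst.
    apply: (@continuous_cvg _ _ _ _ _ (fun n => scale_r (e n) y)); first exact: cP.
    (* Affine in [c], hence convergent along c = 1/(n+1). *)
    have sE c : scale_r c y = row_mx (lsubmx y) 0 + c *: row_mx 0 (rsubmx y).
      by rewrite /scale_r scale_row_mx add_row_mx scaler0 addr0 add0r.
    under eq_fun do rewrite sE; rewrite sE.
    apply: cvgD; first exact: cvg_cst.
    by apply: cvgZl; exact: cvg_harmonic.
  - rewrite (_ : (fun _ => _) = fun y => ((2 / lam) ^+ k * C)%:E * (EFin \o @decw R _) y)%E.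
      apply: integrableZl => //; exact: integrable_decw.
    by apply/funext => y; rewrite -EFinM.
  - by move=> n y _; rewrite lee_fin.
have -> : (((2 * pi / lam) ^+ k)%:E * \int[mu m]_y (P (row_mx y 0))%:E =
    \int[mu (m + k)]_y g_ y)%E.
  rewrite /g_ integral_row_mx; last by apply/measurable_EFinP.
  rewrite -(integral12_prod_meas1 (integrable_row_mx (gi 0))) /fubini_F/=.
  have mP0 : measurable_fun setT (fun y : 'rV[R]_m => P (row_mx y 0)).
    by apply: (measurableT_comp mP); exact: measurable_row_mxl.
  have P0i : (mu m).-integrable setT (fun y => (P (row_mx y 0))%:E).
    apply: (@integrable_bound _ _ _ (mu m) _ _ C mP0 (@integrable_decw R _)) => y.
    rewrite (le_trans (Pw _))// ler_wpM2l// decw_row_mx.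
    by rewrite ler_piMr ?decw_ge0 ?decw_le1.
  rewrite -integralZl//; apply: eq_integral => y _.
  under eq_integral do rewrite row_mxKr scale_r_row_mx scale0r mulrAC EFinM.
  rewrite integralZl//; last exact: integrable_decw.
  by rewrite integral_decw -!EFinM; congr EFin; rewrite !exprMn; ring.
apply: cvge_le cvg_g; apply: nearW => n; rewrite gE.
by apply: integral_poisson_kernel_le; rewrite mulr_gt0.
Qed.

End statement.
End inversion_inequality.

(** * Schwartz functions *)

Section directional_derivatives.
Context {R : realType}.

(** A directional derivative sees only the restriction to a line. This transports derivatives
    between spaces of different dimensions, in particular to functions of one variable. *)
Lemma derive_line (V W : normedModType R) (f : V -> R) (g : W -> R)
    (x v : V) (y w : W) :
  (forall h : R, f (h *: v + x) = g (h *: w + y)) ->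
  (derivable f x v <-> derivable g y w) /\ 'D_v f x = 'D_w g y.
Proof.
move=> fg; rewrite /derivable /derive.
have fgxy : f x = g y by have := fg 0; rewrite !scale0r !add0r.
have -> // : (fun h : R => h^-1 *: ((f \o shift x) (h *: v) - f x)) =
             (fun h : R => h^-1 *: ((g \o shift y) (h *: w) - g y)).
by apply/funext => h /=; rewrite fg fgxy.
Qed.

Lemma is_derive_line (V W : normedModType R) (f : V -> R) (g : W -> R)
    (x v : V) (y w : W) (d : R) :
  (forall h : R, f (h *: v + x) = g (h *: w + y)) ->
  is_derive y w g d -> is_derive x v f d.
Proof.
move=> /derive_line[fg fgE] [dg gd]; apply: DeriveDef; first exact/fg.
by rewrite fgE.
Qed.

(** Restriction to the line through [x] in the direction [v] reduces this to the chain rule in one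
    variable. *)
Lemma is_derive_comp_line (V : normedModType R) (phi : R -> R) (f : V -> R)
    (x v : V) (a d : R) :
  is_derive (f x) (1 : R) phi a -> is_derive x v f d ->
  is_derive x v (phi \o f) (a * d).
Proof.
move=> dphi df.
pose F (h : R) := f (h *: v + x).
have F0 : F 0 = f x by rewrite /F scale0r add0r.
have dF : is_derive (0 : R) (1 : R) F d.
  apply: (is_derive_line _ df) => h.
  by rewrite /F addr0 /GRing.scale /= mulr1.
have dpF : is_derive (0 : R) (1 : R) (phi \o F) (a * d).
  by apply: is_derive1_comp; rewrite F0.
apply: (is_derive_line _ dpF) => h.
by rewrite /= /F addr0 /GRing.scale /= mulr1.
Qed.

Lemma lipschitz_continuous (V W : normedModType R) (f : V -> W) (K : R) :
  (forall x y, `|f x - f y| <= K * `|x - y|) -> continuous f.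
Proof.
move=> fK x; apply/cvgrPdist_lt => e e0.
have K1 : 0 < `|K| + 1 by rewrite ltr_wpDl.
have := @cvgr_dist_lt _ _ _ _ _ (@id V) x (cvg_id) (e / (`|K| + 1)).
rewrite divr_gt0// => /(_ _ isT); apply: filterS => y xy.
rewrite (le_lt_trans (fK _ _))// (le_lt_trans (y := (`|K| + 1) * `|x - y|))//.
  by rewrite ler_wpM2r// (le_trans (ler_norm _))// lerDl.
by rewrite mulrC -ltr_pdivlMr.
Qed.

End directional_derivatives.

Section schwartz_real.
Context {R : realType}.

Definition rapid n (f : 'rV[R]_n -> R) : Prop :=
  forall k, exists C, forall x, `|x| ^+ k * `|f x| <= C.

(** Real counterpart of [schwartz], with a separate bound for each derivative and each power in
    place of seminorms; [schwartzP] relates the two. *)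
Definition rschwartz n (f : 'rV[R]_n -> R) : Prop :=
  smooth f /\ forall s, rapid (partial s f).

(** The last index of the list is differentiated first. *)
Lemma partial_rcons n (s : seq 'I_n) j (f : 'rV[R]_n -> R) :
  partial (rcons s j) f = partial s ('D_(delta_mx ord0 j) f).
Proof. by elim: s => //= i s ->. Qed.

Lemma rschwartz_derive n (f : 'rV[R]_n -> R) j :
  rschwartz f -> rschwartz ('D_(delta_mx ord0 j) f).
Proof.
move=> [sf rf]; split => [s|s]; rewrite -partial_rcons; first exact: sf.
exact: rf.
Qed.

Section rschwartz_basic.
Context n (f : 'rV[R]_n -> R).
Hypothesis fS : rschwartz f.

Lemma rschwartz_continuous : continuous f.
Proof. by have [/(_ [::])[]] := fS. Qed.

Lemma rschwartz_rapid : rapid f.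
Proof. by have [_ /(_ [::])] := fS. Qed.

Lemma rschwartz_is_derive x j :
  is_derive x (delta_mx ord0 j) f ('D_(delta_mx ord0 j) f x).
Proof. by apply: derivableP; have [/(_ [::])[_]] := fS. Qed.
End rschwartz_basic.

Inductive fspan n (B : set ('rV[R]_n -> R)) : ('rV[R]_n -> R) -> Prop :=
| fspan_base f : B f -> fspan B f
| fspan_add f g : fspan B f -> fspan B g -> fspan B (fun x => f x + g x)
| fspan_scale c f : fspan B f -> fspan B (fun x => c * f x).

Lemma rapidD n (f g : 'rV[R]_n -> R) :
  rapid f -> rapid g -> rapid (fun x => f x + g x).
Proof.
move=> rf rg k; have [C fC] := rf k; have [D gD] := rg k; exists (C + D) => x.
by rewrite (le_trans (ler_wpM2l _ (ler_normD _ _))) ?exprn_ge0// mulrDr lerD.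
Qed.

Lemma rapidZ n c (f : 'rV[R]_n -> R) : rapid f -> rapid (fun x => c * f x).
Proof.
move=> rf k; have [C fC] := rf k; exists (`|c| * C) => x.
by rewrite normrM mulrCA ler_wpM2l.
Qed.

Lemma rapid_le n (f g : 'rV[R]_n -> R) C :
  (forall x, `|f x| <= C * `|g x|) -> rapid g -> rapid f.
Proof.
move=> fg rg k; have [D gD] := rg k; exists (`|C| * D) => x.
rewrite (le_trans (ler_wpM2l _ (fg x))) ?exprn_ge0// mulrCA.
by rewrite (le_trans (ler_wpM2r _ (ler_norm C))) ?mulr_ge0 ?exprn_ge0// ler_wpM2l.
Qed.

(* Iterated derivatives need not be computed: partial s f stays in the span. *)
Lemma fspan_rschwartz n (B : set ('rV[R]_n -> R)) :
  (forall f, B f -> continuous f /\ rapid f) ->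
  (forall f j, B f -> exists2 g, fspan B g &
     forall x, is_derive x (delta_mx ord0 j) f (g x)) ->
  forall f, fspan B f -> rschwartz f.
Proof.
move=> Bcr BD.
have span_cr f : fspan B f -> continuous f /\ rapid f.
  elim => {f} [f /Bcr//|f g _ [cf rf] _ [cg rg]|c f _ [cf rf]].
    by split; [move=> x; exact: (cvgD (cf x) (cg x))|exact: rapidD].
  by split; [move=> x; exact: (cvgM (cvg_cst c) (cf x))|exact: rapidZ].
have span_D f j : fspan B f -> exists2 g, fspan B g &
     forall x, is_derive x (delta_mx ord0 j) f (g x).
  elim => {f} [f Bf|f g _ [df Bdf fd] _ [dg Bdg gd]|c f _ [df Bdf fd]].
  - exact: BD.
  - exists (fun x => df x + dg x); first exact: fspan_add.
    by move=> x; have := is_deriveD (fd x) (gd x).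
  - exists (fun x => c * df x); first exact: fspan_scale.
    by move=> x; have := is_deriveZ c (fd x).
move=> f Bf.
have pB s : fspan B (partial s f).
  elim: s => //= j s /(span_D _ j)[g Bg gd].
  by rewrite (_ : 'D_ _ _ = g)//; apply/funext => x; have [_] := gd x.
split=> s; last by have [] := span_cr _ (pB s).
split; first by have [] := span_cr _ (pB s).
by move=> j x; have [g _ /(_ x)[]] := span_D _ j (pB s).
Qed.

End schwartz_real.

(** * Polynomials, modulations, translations and slices *)

Section schwartz_constructions.
Context {R : realType}.

Lemma norm_lsubmx_le m k (x : 'rV[R]_(m + k)) : `|lsubmx x| <= `|x|.
Proof. by apply: norm_rV_le => // i; rewrite mxE norm_coord_le. Qed.

Lemma norm_rsubmx_le m k (x : 'rV[R]_(m + k)) : `|rsubmx x| <= `|x|.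
Proof. by apply: norm_rV_le => // i; rewrite mxE norm_coord_le. Qed.

Lemma norm_row_mx_le m k (x : 'rV[R]_m) (y : 'rV[R]_k) :
  `|row_mx x y| <= `|x| + `|y|.
Proof.
apply: norm_rV_le => [|i]; first exact: addr_ge0.
case: (split_ordP i) => j ->; rewrite ?row_mxEl ?row_mxEr.
  by rewrite (le_trans (norm_coord_le _ _))// lerDl.
by rewrite (le_trans (norm_coord_le _ _))// lerDr.
Qed.

Lemma continuousT_comp (U V W : topologicalType) (f : U -> V) (g : V -> W) :
  continuous f -> continuous g -> continuous (fun x => g (f x)).
Proof. by move=> cf cg x; apply: continuous_comp; [exact: cf|exact: cg]. Qed.

Lemma continuous_lsubmx m k : continuous (fun x : 'rV[R]_(m + k) => lsubmx x).
Proof.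
apply: (@lipschitz_continuous _ _ _ _ 1) => x y.
by rewrite -linearB mul1r norm_lsubmx_le.
Qed.

Lemma continuous_rsubmx m k : continuous (fun x : 'rV[R]_(m + k) => rsubmx x).
Proof.
apply: (@lipschitz_continuous _ _ _ _ 1) => x y.
by rewrite -linearB mul1r norm_rsubmx_le.
Qed.

Lemma continuous_row_mxl m k (c : 'rV[R]_k) :
  continuous (fun x : 'rV[R]_m => row_mx x c).
Proof.
apply: (@lipschitz_continuous _ _ _ _ 1) => x y.
rewrite opp_row_mx add_row_mx subrr mul1r (le_trans (norm_row_mx_le _ _))//.
by rewrite normr0 addr0.
Qed.

Lemma continuous_coord n (j : 'I_n) : continuous (fun x : 'rV[R]_n => x ord0 j).
Proof.
apply: (@lipschitz_continuous _ _ _ _ 1) => x y.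
by rewrite mul1r -[x - y]/(x - y) (le_trans _ (norm_coord_le (x - y) j))// !mxE.
Qed.

(** Polynomial functions, generated through multiplication by one coordinate at a time, so that
    differentiating a generator needs the product rule against a coordinate only. *)
Inductive polyf n : ('rV[R]_n -> R) -> Prop :=
| polyf_cst c : polyf (fun=> c)
| polyf_mulX j p : polyf p -> polyf (fun z => z ord0 j * p z)
| polyf_add p q : polyf p -> polyf q -> polyf (fun z => p z + q z)
| polyf_scale c p : polyf p -> polyf (fun z => c * p z).

Lemma polyf_continuous n (p : 'rV[R]_n -> R) : polyf p -> continuous p.
Proof.
elim=> {p} [c|j p _ cp|p q _ cp _ cq|c p _ cp] x.
- exact: cst_continuous.
- exact: (cvgM (@continuous_coord n j x) (cp x)).
- exact: (cvgD (cp x) (cq x)).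
- exact: (cvgM (cvg_cst c) (cp x)).
Qed.

Lemma is_derive_coord n (x : 'rV[R]_n) i j :
  is_derive x (delta_mx ord0 i) (fun z : 'rV[R]_n => z ord0 j) ((i == j)%:R : R).
Proof.
apply: (@is_derive_line _ _ _ _ (fun t : R => (i == j)%:R * t + x ord0 j)
    _ _ (0 : R) (1 : R)).
  by move=> h; rewrite !mxE eqxx/= eq_sym addr0 /GRing.scale/= mulr1 mulrC.
have := is_deriveD (is_derive_mull ((i == j)%:R : R) 0)
  (is_derive_cst (x ord0 j) (0 : R) (1 : R)).
by move/is_derive_eq; apply; rewrite addr0.
Qed.

Lemma polyf_is_derive n (p : 'rV[R]_n -> R) i : polyf p ->
  exists2 q, polyf q & forall x, is_derive x (delta_mx ord0 i) p (q x).
Proof.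
elim=> {p} [c|j p pp [q pq dq]|p p' _ [q pq dq] _ [q' pq' dq']|c p _ [q pq dq]].
- by exists (fun=> 0); [exact: polyf_cst|move=> x; exact: is_derive_cst].
- exists (fun x : 'rV[R]_n => x ord0 j * q x + (i == j)%:R * p x).
    by apply: polyf_add; [exact: polyf_mulX|exact: polyf_scale].
  move=> x; have := is_deriveM (@is_derive_coord n x i j) (dq x).
  by move/is_derive_eq; apply; rewrite /GRing.scale/=; ring.
- exists (fun x => q x + q' x); first exact: polyf_add.
  by move=> x; exact: is_deriveD.
- exists (fun x => c * q x); first exact: polyf_scale.
  by move=> x; exact: is_deriveZ.
Qed.

Lemma polyf_bound n (p : 'rV[R]_n -> R) : polyf p ->
  exists C M, forall x, `|p x| <= C * (1 + `|x|) ^+ M.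
Proof.
have h x M : 1 <= (1 + `|x : 'rV[R]_n|) ^+ M by rewrite exprn_ege1// lerDl.
elim=> {p} [c|j p _ [C [M pC]]|p q _ [C [M pC]] _ [D [N qD]]|c p _ [C [M pC]]].
- by exists `|c|, 0%N => x; rewrite expr0 mulr1.
- exists C, M.+1 => x; rewrite normrM exprS mulrCA ler_pM//.
  by rewrite (le_trans (norm_coord_le _ _))// lerDr.
- exists (`|C| + `|D|), (M + N)%N => x; rewrite (le_trans (ler_normD _ _))//.
  rewrite mulrDl lerD//.
    rewrite (le_trans (pC x))// exprD mulrA (le_trans (y := `|C| * (1 + `|x|) ^+ M))//.
      by rewrite ler_wpM2r ?ler_norm ?exprn_ge0 ?addr_ge0.
    by rewrite ler_peMr// mulr_ge0// exprn_ge0// addr_ge0.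
  rewrite (le_trans (qD x))// exprD mulrCA (le_trans (y := `|D| * (1 + `|x|) ^+ N))//.
    by rewrite ler_wpM2r ?ler_norm ?exprn_ge0 ?addr_ge0.
  by rewrite ler_peMl// mulr_ge0// exprn_ge0// addr_ge0.
- by exists (`|c| * C), M => x; rewrite normrM -mulrA ler_wpM2l.
Qed.

Lemma polyf_sum n (s : seq 'I_n) (p : 'I_n -> 'rV[R]_n -> R) :
  (forall j, polyf (p j)) -> polyf (fun z => \sum_(j <- s) p j z).
Proof.
move=> pp; elim: s => [|j s ih].
  by under eq_fun do rewrite big_nil; exact: polyf_cst.
by under eq_fun do rewrite big_cons; exact: polyf_add.
Qed.

Lemma polyf_dotrV n (a : 'rV[R]_n) : polyf (dotrV a).
Proof.
rewrite (_ : dotrV a = fun z => \sum_(j <- index_enum _) a ord0 j * (z ord0 j * 1)).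
  by apply: polyf_sum => j; apply/polyf_scale/polyf_mulX/polyf_cst.
by apply/funext => z; rewrite dotrVE; apply: eq_bigr => j _; rewrite mulr1.
Qed.

Lemma is_derive_dotrV n (a x : 'rV[R]_n) j :
  is_derive x (delta_mx ord0 j) (dotrV a) (a ord0 j).
Proof.
apply: (@is_derive_line _ _ _ _ (fun t : R => a ord0 j * t + dotrV a x)
    _ _ (0 : R) (1 : R)).
  move=> h; rewrite addr0 /GRing.scale/= mulr1 !dotrVE.
  under eq_bigr do rewrite !mxE eqxx /= mulrDr.
  rewrite big_split/= (bigD1 j)//= eqxx mulr1 big1 ?addr0// => i /negbTE ->.
  by rewrite !mulr0.
have := is_deriveD (is_derive_mull (a ord0 j) 0)
  (is_derive_cst (dotrV a x) (0 : R) (1 : R)).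
by move/is_derive_eq; apply; rewrite addr0.
Qed.

Lemma exprD_le (a b : R) k : 0 <= a -> 0 <= b ->
  (a + b) ^+ k <= 2 ^+ k * (a ^+ k + b ^+ k).
Proof.
move=> a0 b0; wlog ab : a b a0 b0 / a <= b.
  move=> H; have [ab|/ltW ba] := leP a b; first exact: H.
  by rewrite (addrC a) (addrC (a ^+ k)); exact: H.
rewrite (le_trans (y := (2 * b) ^+ k))//.
  rewrite lerXn2r ?nnegrE ?addr_ge0 ?mulr_ge0//.
  by rewrite [2]mulr2n mulrDl mul1r lerD2r.
by rewrite exprMn ler_wpM2l ?exprn_ge0// lerDr exprn_ge0.
Qed.

Lemma rapid_translate n (f : 'rV[R]_n -> R) x0 :
  rapid f -> rapid (fun x => f (x - x0)).
Proof.
move=> rf k; have [C fC] := rf k; have [D fD] := rf 0%N.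
exists (2 ^+ k * (C + `|x0| ^+ k * D)) => x.
apply: (le_trans (y := (2 ^+ k * (`|x - x0| ^+ k + `|x0| ^+ k)) * `|f (x - x0)|)).
  rewrite ler_wpM2r// (le_trans _ (exprD_le _ _ _))//.
  rewrite lerXn2r ?nnegrE ?addr_ge0//.
  by rewrite -[in leLHS](subrK x0 x) ler_normD.
rewrite -mulrA ler_wpM2l ?exprn_ge0// mulrDl lerD// ler_wpM2l ?exprn_ge0//.
by have := fD (x - x0); rewrite expr0 mul1r.
Qed.

(** The phase [theta] is free so that the family is stable under differentiation: the derivative of
    cos is cos shifted by pi/2, and sines need no generator of their own. *)
Definition modulated n (a x0 : 'rV[R]_n) : set ('rV[R]_n -> R) :=
  [set f | exists theta phi, rschwartz phi /\
     f = fun x => cos (dotrV a x + theta) * phi (x - x0)].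

Lemma modulated_rschwartz n (a x0 : 'rV[R]_n) f :
  fspan (modulated a x0) f -> rschwartz f.
Proof.
have ct : continuous (fun x : 'rV[R]_n => x - x0).
  apply: (@lipschitz_continuous _ _ _ _ 1) => x y.
  by rewrite mul1r opprB addrA subrK.
move: f; apply: fspan_rschwartz => [f|f j] [theta [phi [pS ->]]].
  split.
    have ca : continuous (fun y => dotrV a y + theta).
      move=> y; exact: (cvgD (@polyf_continuous _ _ (polyf_dotrV a) y) (cvg_cst _)).
    have cc := continuousT_comp ca (@continuous_cos R).
    have cp := continuousT_comp ct (rschwartz_continuous pS).
    by move=> x; exact: (cvgM (cc x) (cp x)).
  apply: (rapid_le (C := 1) _ (rapid_translate x0 (rschwartz_rapid pS))) => x.
  by rewrite mul1r normrM ler_piMl// norm_cos_le1.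
exists (fun x => a ord0 j * (cos (dotrV a x + (theta + pi / 2)) * phi (x - x0)) +
  cos (dotrV a x + theta) * 'D_(delta_mx ord0 j) phi (x - x0)).
  apply: fspan_add.
    by apply: fspan_scale; apply: fspan_base; exists (theta + pi / 2), phi.
  apply: fspan_base; exists theta, ('D_(delta_mx ord0 j) phi).
  by split => //; exact: rschwartz_derive.
move=> x.
have dp : is_derive x (delta_mx ord0 j) (fun y => phi (y - x0))
    ('D_(delta_mx ord0 j) phi (x - x0)).
  apply: (is_derive_line _ (rschwartz_is_derive pS (x - x0) j)) => h.
  by rewrite addrA.
have da : is_derive x (delta_mx ord0 j) (fun y => dotrV a y + theta) (a ord0 j).
  have := is_deriveD (is_derive_dotrV a x j) (is_derive_cst theta x (delta_mx ord0 j)).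
  by move/is_derive_eq; apply; rewrite addr0.
have dc := @is_derive_comp_line _ _ cos (fun y => dotrV a y + theta) _ _ _ _
  (is_derive_cos _) da.
have := is_deriveM dc dp; move/is_derive_eq; apply.
by rewrite /GRing.scale/= addrA cosDpihalf; ring.
Qed.

(** Differentiating a slice gives the slice of a derivative in one of the first [m] directions, so
    the slices at a fixed [c] are stable. *)
Definition sliced m k (c : 'rV[R]_k) : set ('rV[R]_m -> R) :=
  [set f | exists2 phi : 'rV[R]_(m + k) -> R, rschwartz phi &
     f = fun y => phi (row_mx y c)].

Lemma sliced_rschwartz m k (c : 'rV[R]_k) (phi : 'rV[R]_(m + k) -> R) :
  rschwartz phi -> rschwartz (fun y => phi (row_mx y c)).
Proof.
move=> pS; suff H : forall f, fspan (@sliced m k c) f -> rschwartz f.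
  by apply: H; apply: fspan_base; exists phi.
move=> {phi pS}; apply: fspan_rschwartz => [f|f j] [phi pS ->].
  split.
    exact: (continuousT_comp (@continuous_row_mxl _ _ c) (rschwartz_continuous pS)).
  move=> N; have [C pC] := rschwartz_rapid pS N; exists C => y.
  rewrite (le_trans _ (pC (row_mx y c)))// ler_wpM2r// lerXn2r ?nnegrE//.
  by rewrite -[in leLHS](row_mxKl y c) norm_lsubmx_le.
exists (fun y => 'D_(delta_mx ord0 (lshift k j)) phi (row_mx y c)).
  apply: fspan_base; exists ('D_(delta_mx ord0 (lshift k j)) phi) => //.
  exact: rschwartz_derive.
move=> y; apply: (is_derive_line _ (rschwartz_is_derive pS _ _)) => h.
by rewrite delta_mx_lshift scale_row_mx add_row_mx scaler0 add0r.
Qed.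

End schwartz_constructions.

(** * Tensor products with polynomials times Gaussians *)

Section tensor_gaussian.
Context {R : realType}.

(** From the exponential series, (1+s)^(L+1) / (L+1)! is at most exp(1+s), and one power of 1+s can
    be given up because it is at least 1. The factor exp(1) accounts for the shift from [s] to
    1+s. *)
Lemma expr_expRN_bounded (L : nat) (s : R) : 0 <= s ->
  (1 + s) ^+ L * expR (- s) <= L.+1`!%:R * expR 1.
Proof.
move=> s0; rewrite expRN ler_pdivrMr ?expR_gt0// -mulrA -expRD.
have s1 : 0 <= 1 + s by rewrite addr_ge0.
rewrite mulrC -ler_pdivrMr ?ltr0n ?fact_gt0//.
rewrite (le_trans _ (expR_ge1Dxn L s1))//.
rewrite (le_trans (y := (1 + s) ^+ L.+1 / L.+1`!%:R))//; last by rewrite lerDr.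
rewrite ler_wpM2r ?invr_ge0// exprS ler_peMl ?exprn_ge0// lerDl//.
Qed.

Lemma polyf_mul n (p q : 'rV[R]_n -> R) : polyf p -> polyf q ->
  polyf (fun z => p z * q z).
Proof.
move=> pp pq; elim: pp => {p} [c|j p _ ih|p p' _ ih _ ih'|c p _ ih].
- exact: polyf_scale.
- by under eq_fun do rewrite -mulrA; exact: polyf_mulX.
- by under eq_fun do rewrite mulrDl; exact: polyf_add.
- by under eq_fun do rewrite -mulrA; exact: polyf_scale.
Qed.

Section quadratic.
Variables (k : nat) (a : 'rV[R]_k).
Hypothesis a_gt0 : forall j, 0 < a ord0 j.

(** The trailing factor 1 makes each summand an instance of the constructors of [polyf]. *)
Definition quadf (z : 'rV[R]_k) : R :=
  \sum_j a ord0 j * (z ord0 j * (z ord0 j * 1)).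

Lemma polyf_quadf : polyf quadf.
Proof.
apply: (@polyf_sum _ _ _ (fun j z => a ord0 j * (z ord0 j * (z ord0 j * 1)))) => j.
by apply/polyf_scale/polyf_mulX/polyf_mulX/polyf_cst.
Qed.

Lemma quadf_ge0 z : 0 <= quadf z.
Proof.
apply: sumr_ge0 => j _; rewrite mulr1 -expr2 mulr_ge0 ?sqr_ge0// ltW//.
Qed.

Lemma norm_le_quadf : exists2 K, 0 <= K & forall z, 1 + `|z| <= K * (1 + quadf z).
Proof.
pose A := \sum_j (a ord0 j)^-1.
have A0 : 0 <= A by apply: sumr_ge0 => j _; rewrite invr_ge0 ltW.
(* Coordinatewise |z_j| <= 1 + z_j^2, and z_j^2 is at most [quadf z] divided by a_j; [A] dominates
   every 1/a_j. Hence 1 + |z| <= 2 + A [quadf z]. *)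
exists (2 + A) => [|z]; first by rewrite addr_ge0.
have s0 := quadf_ge0 z.
have : `|z| <= 1 + A * quadf z.
  apply: norm_rV_le => [|j]; first by rewrite addr_ge0// mulr_ge0.
  have h1 : a ord0 j * z ord0 j ^+ 2 <= quadf z.
    rewrite /quadf (bigD1 j)//= mulr1 -expr2 lerDl sumr_ge0// => i _.
    by rewrite mulr1 -expr2 mulr_ge0 ?sqr_ge0// ltW.
  have h2 : z ord0 j ^+ 2 <= A * quadf z.
    apply: (le_trans (y := (a ord0 j)^-1 * quadf z)).
      by rewrite ler_pdivlMl.
    rewrite ler_wpM2r// /A (bigD1 j)//= lerDl sumr_ge0// => i _.
    by rewrite invr_ge0 ltW.
  rewrite (le_trans _ (_ : 1 + z ord0 j ^+ 2 <= _))// ?lerD2l//.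
  rewrite -(real_normK (num_real (z ord0 j))); set u := `|z ord0 j|.
  by have := sqr_ge0 (u - 1); nra.
move=> h; have := mulr_ge0 A0 s0; nra.
Qed.

(** By [norm_le_quadf] all powers of 1 + |z| become powers of 1 + [quadf z], which
    [expr_expRN_bounded] absorbs into the exponential. *)
Lemma rapid_polyf_gauss (p : 'rV[R]_k -> R) : polyf p ->
  rapid (fun z => p z * expR (- quadf z)).
Proof.
move=> /polyf_bound[C [M pC]] N; have [K K0 zK] := norm_le_quadf.
exists (`|C| * (K ^+ (N + M) * ((N + M).+1`!%:R * expR 1))) => z.
have n0 : 0 <= 1 + `|z| by rewrite addr_ge0.
rewrite normrM (ger0_norm (expR_ge0 _)).
apply: (le_trans (y := (1 + `|z|) ^+ N *
    (`|C| * (1 + `|z|) ^+ M * expR (- quadf z)))).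
  apply: ler_pM; rewrite ?exprn_ge0 ?mulr_ge0 ?expR_ge0//.
    by rewrite lerXn2r ?nnegrE// lerDr.
  rewrite ler_wpM2r ?expR_ge0// (le_trans (pC z))// ler_wpM2r ?exprn_ge0//.
  exact: ler_norm.
rewrite -mulrA mulrCA ler_wpM2l// mulrA -exprD.
apply: (le_trans (y := (K * (1 + quadf z)) ^+ (N + M) * expR (- quadf z))).
  by rewrite ler_wpM2r ?expR_ge0// lerXn2r ?nnegrE ?mulr_ge0 ?addr_ge0 ?quadf_ge0.
rewrite exprMn -mulrA ler_wpM2l ?exprn_ge0//.
by rewrite expr_expRN_bounded// quadf_ge0.
Qed.

End quadratic.

(** After splitting the power of the norm between the two blocks, each term uses the decay of one
    factor and the boundedness of the other. *)
Lemma rapid_tensor m k (f : 'rV[R]_m -> R) (h : 'rV[R]_k -> R) :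
  rapid f -> rapid h -> rapid (fun x : 'rV[R]_(m + k) => f (lsubmx x) * h (rsubmx x)).
Proof.
move=> rf rh N; have [C fC] := rf N; have [C' fC'] := rf 0%N.
have [D hD] := rh N; have [D' hD'] := rh 0%N.
exists (2 ^+ N * (C * D' + C' * D)) => x.
have /(_ (lsubmx x)) := fC'; have /(_ (rsubmx x)) := hD'.
rewrite !expr0 !mul1r => hx fx.
rewrite normrM; apply: (le_trans (y := 2 ^+ N *
    (`|lsubmx x| ^+ N + `|rsubmx x| ^+ N) * (`|f (lsubmx x)| * `|h (rsubmx x)|))).
  rewrite ler_wpM2r ?mulr_ge0// (le_trans _ (exprD_le _ _ _))//.
  rewrite lerXn2r ?nnegrE ?addr_ge0//.
  by rewrite -[in leLHS](hsubmxK x) norm_row_mx_le.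
rewrite -mulrA ler_wpM2l ?exprn_ge0// mulrDl lerD//.
  by rewrite mulrA ler_pM// mulr_ge0// exprn_ge0.
by rewrite mulrCA ler_pM// mulr_ge0// exprn_ge0.
Qed.

Section tensor_derivatives.
Variables (m k : nat) (a : 'rV[R]_k).
Hypothesis a_gt0 : forall j, 0 < a ord0 j.

(** The polynomial [p] closes the family under differentiation: a derivative in the first block acts
    on [phi], and one in the second block only changes [p]. *)
Definition gauss_tensor : set ('rV[R]_(m + k) -> R) :=
  [set f | exists phi p, [/\ rschwartz phi, polyf p &
     f = fun x => phi (lsubmx x) * (p (rsubmx x) * expR (- quadf a (rsubmx x)))]].

Lemma gauss_tensor_rschwartz f : fspan gauss_tensor f -> rschwartz f.
Proof.
move: f; apply: fspan_rschwartz => [f|f i] [phi [p [pS pp ->]]].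
  split; last first.
    apply: (rapid_tensor (f := phi) (h := fun z => p z * expR (- quadf a z))).
      exact: rschwartz_rapid.
    exact: rapid_polyf_gauss.
  have cf := continuousT_comp (@continuous_lsubmx R m k) (rschwartz_continuous pS).
  have cp := continuousT_comp (@continuous_rsubmx R m k) (polyf_continuous pp).
  have cN : continuous (fun z => - quadf a z).
    by move=> z; exact: (cvgN (@polyf_continuous _ _ _ (polyf_quadf a) z)).
  have ce := continuousT_comp (continuousT_comp (@continuous_rsubmx R m k) cN)
    (@continuous_expR R).
  by move=> x; exact: (cvgM (cf x) (cvgM (cp x) (ce x))).
case: (split_ordP i) => j -> {i}.
  exists (fun x => 'D_(delta_mx ord0 j) phi (lsubmx x) *
      (p (rsubmx x) * expR (- quadf a (rsubmx x)))).
    apply: fspan_base; exists ('D_(delta_mx ord0 j) phi), p; split => //.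
    exact: rschwartz_derive.
  move=> x; rewrite delta_mx_lshift.
  apply: (@is_derive_line _ _ _ _ (fun y : 'rV[R]_m => phi y *
     (p (rsubmx x) * expR (- quadf a (rsubmx x)))) _ _ (lsubmx x) (delta_mx ord0 j)).
    by move=> h; rewrite !linearD !linearZ/= row_mxKl row_mxKr scaler0 add0r.
  have := is_deriveM (rschwartz_is_derive pS (lsubmx x) j)
    (is_derive_cst (p (rsubmx x) * expR (- quadf a (rsubmx x)))
       (lsubmx x) (delta_mx ord0 j)).
  by move/is_derive_eq; apply; rewrite /GRing.scale/= mulr0 add0r mulrC.
have [q pq dq] := polyf_is_derive j pp.
have [r pr dr] := polyf_is_derive j (polyf_quadf a).
exists (fun x => phi (lsubmx x) *
    ((q (rsubmx x) + (-1) * (r (rsubmx x) * p (rsubmx x))) *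
     expR (- quadf a (rsubmx x)))).
  apply: fspan_base; exists phi, (fun z => q z + (-1) * (r z * p z)); split => //.
  by apply: polyf_add => //; apply: polyf_scale; exact: polyf_mul.
move=> x; rewrite delta_mx_rshift.
apply: (@is_derive_line _ _ _ _ (fun z : 'rV[R]_k => phi (lsubmx x) *
   (p z * expR (- quadf a z))) _ _ (rsubmx x) (delta_mx ord0 j)).
  by move=> h; rewrite !linearD !linearZ/= row_mxKl row_mxKr scaler0 add0r.
have dE := @is_derive_comp_line _ _ expR (fun z => - quadf a z) _ _ _ _
  (is_derive_expR _) (is_deriveN (dr (rsubmx x))).
have := is_deriveZ (phi (lsubmx x)) (is_deriveM (dq (rsubmx x)) dE).
by move/is_derive_eq; apply; rewrite /GRing.scale/=; ring.
Qed.

End tensor_derivatives.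
End tensor_gaussian.

Section schwartz_real_imaginary.
Context {R : realType}.

Lemma normc_Re_le (z : R[i]) : `|complex.Re z| <= normc z.
Proof.
by case: z => x y /=; rewrite -sqrtr_sqr ler_wsqrtr// lerDl sqr_ge0.
Qed.

Lemma normc_Im_le (z : R[i]) : `|complex.Im z| <= normc z.
Proof.
by case: z => x y /=; rewrite -sqrtr_sqr ler_wsqrtr// lerDr sqr_ge0.
Qed.

Lemma normc_le (z : R[i]) : normc z <= `|complex.Re z| + `|complex.Im z|.
Proof.
case: z => x y /=; rewrite -[leRHS]ger0_norm ?addr_ge0// -sqrtr_sqr ler_wsqrtr//.
rewrite sqrrD !real_normK ?num_real// -addrA lerD2l lerDr.
by rewrite mulrn_wge0// mulr_ge0.
Qed.

Lemma normc_ge0 (z : R[i]) : 0 <= normc z.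
Proof. by case: z => x y; rewrite sqrtr_ge0. Qed.

Section schwartzP.
Context n (phi : 'rV[R]_n -> R[i]).

Lemma schwartz_bound k s : schwartz phi ->
  exists C, forall x, `|x| ^+ k * normc (Cpartial s phi x) <= C.
Proof.
move=> [_ /(_ (maxn k (size s)))].
set S := schwartz_norm _ _ => Soo.
have xS x : ((`|x| ^+ k * normc (Cpartial s phi x))%:E <= S)%E.
  apply: ereal_sup_ubound; exists k, s, x.
  by rewrite leq_maxl leq_maxr.
exists (fine S) => x; have := xS x; move: Soo.
by case: S {xS} => //= r _; rewrite lee_fin.
Qed.

(** The converse must turn separate bounds into one bound on a supremum; this works because
    [schwartz_norm N] involves finitely many powers and index lists. *)
Lemma schwartzP : schwartz phi <->
  rschwartz (@complex.Re R \o phi) /\ rschwartz (@complex.Im R \o phi).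
Proof.
split=> [pS|[[sR rR] [sI rI]]].
  have [[sR sI] _] := pS; split; split=> // s k.
    have [C hC] := schwartz_bound k s pS; exists C => x.
    rewrite (le_trans _ (hC x))// ler_wpM2l ?exprn_ge0//.
    exact: (normc_Re_le (Cpartial s phi x)).
  have [C hC] := schwartz_bound k s pS; exists C => x.
  rewrite (le_trans _ (hC x))// ler_wpM2l ?exprn_ge0//.
  exact: (normc_Im_le (Cpartial s phi x)).
split=> // N.
have /choice[B hB] (ks : nat * seq 'I_n) : exists C, 0 <= C /\ forall x,
    `|x| ^+ ks.1 * normc (Cpartial ks.2 phi x) <= C.
  have [C hC] := rR ks.2 ks.1; have [D hD] := rI ks.2 ks.1.
  have h x : `|x| ^+ ks.1 * normc (Cpartial ks.2 phi x) <= C + D.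
    rewrite (le_trans (ler_wpM2l _ (normc_le _))) ?exprn_ge0// mulrDr lerD//=.
  exists (C + D); split => //; apply: le_trans (h 0).
  by rewrite mulr_ge0 ?exprn_ge0 ?normc_ge0.
(* The sum of all the nonnegative bounds dominates each of them; lists of length [l] are enumerated
   as tuples, and [inord] and [in_tuple] select the relevant term. *)
pose M := \sum_(k < N.+1) \sum_(l < N.+1) \sum_(t : l.-tuple 'I_n) B (k : nat, t : seq _).
apply: (le_lt_trans _ (ltry M)).
apply: ge_ereal_sup => _ [k [s [x [kN sN ->]]]]; rewrite lee_fin.
have [_ hks] := hB (k, s); apply: le_trans (hks x) _.
have B0 ks : 0 <= B ks by have [] := hB ks.
rewrite /M (bigD1 (inord k : 'I_N.+1))//= inordK// -[leLHS]addr0 lerD//; last first.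
  by do 3 (apply: sumr_ge0 => ? _).
rewrite (bigD1 (inord (size s) : 'I_N.+1))//= -[leLHS]addr0 lerD//; last first.
  by do 2 (apply: sumr_ge0 => ? _).
rewrite inordK// (bigD1 (in_tuple s))//= lerDl.
by apply: sumr_ge0 => ? _.
Qed.

End schwartzP.
End schwartz_real_imaginary.

(** * The Gabor transform of a bounded continuous function *)

Section decaying_functions.
Context {R : realType}.
Local Notation mu := (@lebesgue_rV R).

(** Each coordinate is at most the sup norm, so [decw y] is at least (1 + |y|^2)^(-n). Decay of
    order 2n in the norm is thereby converted into a multiple of the product weight. *)
Lemma decw_lower n (y : 'rV[R]_n) : 1 <= 2 ^+ n * (1 + `|y| ^+ (2 * n)) * decw y.
Proof.
have h : (1 + `|y| ^+ 2) ^+ n <= 2 ^+ n * (1 + `|y| ^+ (2 * n)).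
  by rewrite exprM -[X in _ * (X + _)](expr1n _ n) exprD_le// exprn_ge0.
have y0 : 0 < 1 + `|y| ^+ 2 by rewrite ltr_pwDl ?sqr_ge0.
rewrite (le_trans (y := (1 + `|y| ^+ 2) ^+ n * decw y))//; last first.
  by rewrite ler_wpM2r ?decw_ge0.
rewrite -ler_pdivrMl ?exprn_gt0// mulr1 -exprVn.
rewrite -[X in _ ^+ X <= _]card_ord -prodr_const; apply: ler_prod => j _.
rewrite invr_ge0 ltW//= lef_pV2 ?posrE//.
rewrite /oneDsqr lerD2l -(real_normK (num_real (y ord0 j))).
by rewrite lerXn2r ?nnegrE// norm_coord_le.
Qed.

Lemma rapid_decw n (f : 'rV[R]_n -> R) : rapid f ->
  exists C, forall y, (1 + `|y|) * `|f y| <= C * decw y.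
Proof.
(* The orders 0, 1, 2n and 2n+1 are those in the expansion of (1 + |y|)(1 + |y|^(2n)). *)
move=> rf; have [C0 h0] := rf 0%N; have [C1 h1] := rf 1%N.
have [C2 h2] := rf (2 * n)%N; have [C3 h3] := rf (2 * n).+1.
exists (2 ^+ n * (C0 + C1 + C2 + C3)) => y.
have z0 : 0 <= (1 + `|y|) * `|f y| by rewrite mulr_ge0// addr_ge0.
apply: (le_trans (ler_peMr z0 (decw_lower y))).
rewrite mulrA ler_wpM2r ?decw_ge0// mulrCA ler_wpM2l ?exprn_ge0//.
have := h0 y; have := h1 y; have := h2 y; have := h3 y.
rewrite exprS expr0 expr1 mul1r => k3 k2 k1 k0.
move: (`|f y|) (`|y|) (`|y| ^+ (2 * n)) k0 k1 k2 k3 => F u v k0 k1 k2 k3.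
rewrite (_ : _ * _ * _ = F + u * F + v * F + u * v * F); last by ring.
by rewrite !lerD.
Qed.

(** The factor 1 + |y| controls a first moment, which makes [fourier] Lipschitz in the frequency.
    Unlike Schwartz functions, this class is stable under multiplication by bounded continuous
    functions, hence contains the integrands of Gabor transforms. *)
Definition decaying n (h : 'rV[R]_n -> R[i]) : Prop :=
  [/\ continuous (@complex.Re R \o h), continuous (@complex.Im R \o h) &
      exists C, forall y, (1 + `|y|) * normc (h y) <= C * decw y].

Lemma schwartz_decaying n (h : 'rV[R]_n -> R[i]) : schwartz h -> decaying h.
Proof.
move=> /schwartzP[hR hI]; split; [exact: rschwartz_continuous..|].
have [C hC] := rapid_decw (rschwartz_rapid hR).
have [D hD] := rapid_decw (rschwartz_rapid hI); exists (C + D) => y.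
rewrite (le_trans (ler_wpM2l _ (normc_le _))) ?addr_ge0// mulrDr [leRHS]mulrDl.
by rewrite lerD.
Qed.

Lemma Re_mul (z w : R[i]) : complex.Re (z * w) =
  complex.Re z * complex.Re w - complex.Im z * complex.Im w.
Proof. by case: z => a b; case: w => c d. Qed.

Lemma Im_mul (z w : R[i]) : complex.Im (z * w) =
  complex.Re z * complex.Im w + complex.Im z * complex.Re w.
Proof. by case: z => a b; case: w => c d. Qed.

Lemma decayingM n (b h : 'rV[R]_n -> R[i]) :
  bounded_continuous b -> decaying h -> decaying (fun y => b y * h y).
Proof.
move=> [bR bI [M bM]] [hR hI [C hC]]; split.
- rewrite (_ : _ \o _ = fun y => (@complex.Re R \o b) y * (@complex.Re R \o h) y -
      (@complex.Im R \o b) y * (@complex.Im R \o h) y).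
    by move=> y; exact: (cvgB (cvgM (bR y) (hR y)) (cvgM (bI y) (hI y))).
  by apply/funext => y /=; rewrite Re_mul.
- rewrite (_ : _ \o _ = fun y => (@complex.Re R \o b) y * (@complex.Im R \o h) y +
      (@complex.Im R \o b) y * (@complex.Re R \o h) y).
    by move=> y; exact: (cvgD (cvgM (bR y) (hI y)) (cvgM (bI y) (hR y))).
  by apply/funext => y /=; rewrite Im_mul.
- exists (M * C) => y; rewrite normcM mulrCA -mulrA.
  rewrite (le_trans (ler_wpM2r _ (bM y))) ?mulr_ge0 ?addr_ge0 ?normc_ge0//.
  by rewrite ler_wpM2l// (le_trans (normc_ge0 _) (bM y)).
Qed.

Lemma bounded_continuous_cst n (c : R[i]) :
  bounded_continuous (fun _ : 'rV[R]_n => c).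
Proof.
split; [exact: cst_continuous..|].
by exists (normc c).
Qed.

Lemma normc_expi (t : R) : normc (expi t) = 1.
Proof. by rewrite /normc /expi cos2Dsin2 sqrtr1. Qed.

Lemma bounded_continuous_expi n (p : 'rV[R]_n -> R) : continuous p ->
  bounded_continuous (fun y => expi (p y)).
Proof.
move=> cp; split.
- exact: (continuousT_comp cp (@continuous_cos R)).
- exact: (continuousT_comp cp (@continuous_sin R)).
- by exists 1 => y; rewrite normc_expi.
Qed.

Section decaying_integrable.
Context n (h : 'rV[R]_n -> R[i]).
Hypothesis hd : decaying h.

Lemma decaying_bound : exists C, forall y, normc (h y) <= C * decw y.
Proof.
have [_ _ [C hC]] := hd; exists C => y; apply: le_trans (hC y).
by rewrite ler_peMl ?normc_ge0// lerDl.
Qed.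

Lemma measurable_decaying_Re : measurable_fun setT (@complex.Re R \o h).
Proof. by have [? _ _] := hd; exact: continuous_measurable_rV. Qed.

Lemma measurable_decaying_Im : measurable_fun setT (@complex.Im R \o h).
Proof. by have [_ ? _] := hd; exact: continuous_measurable_rV. Qed.

Lemma integrable_decaying_Re :
  (mu n).-integrable setT (EFin \o (@complex.Re R \o h)).
Proof.
have [C hC] := decaying_bound.
apply: (integrable_bound measurable_decaying_Re (@integrable_decw R n)) => y.
exact: le_trans (normc_Re_le _) (hC y).
Qed.

Lemma integrable_decaying_Im :
  (mu n).-integrable setT (EFin \o (@complex.Im R \o h)).
Proof.
have [C hC] := decaying_bound.
apply: (integrable_bound measurable_decaying_Im (@integrable_decw R n)) => y.
exact: le_trans (normc_Im_le _) (hC y).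
Qed.

Lemma Cintegral_Re : ((complex.Re (Cintegral (mu n) h))%:E =
  \int[mu n]_y (complex.Re (h y))%:E)%E.
Proof.
by rewrite /= fineK//; exact: (integrable_fin_num _ integrable_decaying_Re).
Qed.

Lemma Cintegral_Im : ((complex.Im (Cintegral (mu n) h))%:E =
  \int[mu n]_y (complex.Im (h y))%:E)%E.
Proof.
by rewrite /= fineK//; exact: (integrable_fin_num _ integrable_decaying_Im).
Qed.

Lemma Cintegral_mul (c : R[i]) :
  Cintegral (mu n) (fun y => c * h y) = c * Cintegral (mu n) h.
Proof.
have iR := integrable_decaying_Re; have iI := integrable_decaying_Im.
have eR : complex.Re (Cintegral (mu n) (fun y => c * h y)) =
    complex.Re c * complex.Re (Cintegral (mu n) h) -
    complex.Im c * complex.Im (Cintegral (mu n) h).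
  rewrite {1}/Cintegral/= /Rintegral -mulNr.
  under eq_integral do rewrite /= Re_mul -mulNr.
  by rewrite (integralDZ _ _ iR iI (esym Cintegral_Re) (esym Cintegral_Im)).
have eI : complex.Im (Cintegral (mu n) (fun y => c * h y)) =
    complex.Re c * complex.Im (Cintegral (mu n) h) +
    complex.Im c * complex.Re (Cintegral (mu n) h).
  rewrite {1}/Cintegral/= /Rintegral.
  under eq_integral do rewrite /= Im_mul.
  by rewrite (integralDZ _ _ iI iR (esym Cintegral_Im) (esym Cintegral_Re)).
by apply/eqP; rewrite eq_complex eR eI Re_mul Im_mul !eqxx.
Qed.

End decaying_integrable.

End decaying_functions.

Section gabor_transform.
Context {R : realType}.
Local Notation mu := (@lebesgue_rV R).

Lemma derive_le1_lipschitz (f df : R -> R) :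
  (forall x : R, is_derive x 1 f (df x)) -> (forall x, `|df x| <= 1) ->
  forall s t, `|f s - f t| <= `|s - t|.
Proof.
move=> dfE df1 s t; wlog st : s t / s < t => [H|].
  have [st|ts|->] := ltgtP s t; [exact: H| |by rewrite !subrr].
  by rewrite distrC (distrC s) H.
have cf : {within `[s, t], continuous f}.
  apply: continuous_subspaceT => x.
  by apply: differentiable_continuous; apply/derivable1_diffP; have [] := dfE x.
have [c _ fE] := MVT st (fun x _ => dfE x) cf.
by rewrite distrC fE normrM (distrC s) ler_piMl.
Qed.

Lemma cos_lipschitz (s t : R) : `|cos s - cos t| <= `|s - t|.
Proof.
apply: (derive_le1_lipschitz (fun x => is_derive_cos x)) => x.
by rewrite normrN norm_sin_le1.
Qed.

Lemma sin_lipschitz (s t : R) : `|sin s - sin t| <= `|s - t|.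
Proof.
by apply: (derive_le1_lipschitz (fun x => is_derive_sin x)) => x; exact: norm_cos_le1.
Qed.

Lemma expi_lipschitz (s t : R) : normc (expi s - expi t) <= 2 * `|s - t|.
Proof.
rewrite (le_trans (normc_le _))//= mulr2n mulrDl mul1r lerD//.
  exact: cos_lipschitz.
exact: sin_lipschitz.
Qed.

Lemma expiD (s t : R) : expi (s + t) = expi s * expi t.
Proof.
apply/eqP; rewrite eq_complex Re_mul Im_mul /= cosD sinD.
by rewrite eqxx/= addrC eqxx.
Qed.

Lemma Re_sub (z w : R[i]) : complex.Re (z - w) = complex.Re z - complex.Re w.
Proof. by case: z => a b; case: w => c d. Qed.

Lemma Im_sub (z w : R[i]) : complex.Im (z - w) = complex.Im z - complex.Im w.
Proof. by case: z => a b; case: w => c d. Qed.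

Lemma norm_dotrV_le n (x y : 'rV[R]_n) : `|dotrV x y| <= n%:R * `|x| * `|y|.
Proof.
rewrite dotrVE (le_trans (ler_norm_sum _ _ _))//.
apply: (le_trans (y := \sum_(j < n) `|x| * `|y|)).
  by apply: ler_sum => j _; rewrite normrM ler_pM ?norm_coord_le.
by rewrite sumr_const card_ord -mulrA mulr_natl.
Qed.

Lemma Rintegral_dist_le n (f g : 'rV[R]_n -> R) (B : R) :
  (mu n).-integrable setT (EFin \o f) -> (mu n).-integrable setT (EFin \o g) ->
  (forall y, `|f y - g y| <= B * decw y) ->
  `|Rintegral (mu n) setT f - Rintegral (mu n) setT g| <= B * pi ^+ n.
Proof.
move=> fi gi fg.
have di : (mu n).-integrable setT (EFin \o (fun y => f y - g y)).
  by have := integrableB measurableT fi gi.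
rewrite -RintegralB// (le_trans (le_normr_Rintegral measurableT di))//.
have -> : B * pi ^+ n = Rintegral (mu n) setT (fun y => B * decw y).
  by rewrite RintegralZl// ?integrable_decw// /Rintegral integral_decw.
apply: le_Rintegral => //.
- exact: (integrable_norm di).
- by have := integrableZl measurableT B (@integrable_decw R n).
Qed.

(** The normalizing power of 2 pi hbar is left out, and [lam] will be 1/hbar. *)
Definition fourier n (lam : R) (h : 'rV[R]_n -> R[i]) (xi : 'rV[R]_n) : R[i] :=
  Cintegral (mu n) (fun y => expi (- (lam * dotrV xi y)) * h y).

Section fourier_continuity.
Context n (lam : R) (h : 'rV[R]_n -> R[i]).
Hypothesis hd : decaying h.

Lemma bounded_continuous_wave xi :
  bounded_continuous (fun y : 'rV[R]_n => expi (- (lam * dotrV xi y))).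
Proof.
apply: bounded_continuous_expi => y.
exact: (cvgN (cvgM (cvg_cst lam) (@polyf_continuous _ _ _ (polyf_dotrV xi) y))).
Qed.

Lemma decaying_wave xi : decaying (fun y => expi (- (lam * dotrV xi y)) * h y).
Proof. exact: decayingM (bounded_continuous_wave xi) hd. Qed.

Lemma fourier_lipschitz : exists K, forall xi eta,
  `|complex.Re (fourier lam h xi) - complex.Re (fourier lam h eta)|
     <= K * `|xi - eta| /\
  `|complex.Im (fourier lam h xi) - complex.Im (fourier lam h eta)|
     <= K * `|xi - eta|.
Proof.
have [_ _ [C hC]] := hd.
(* The factor 2 comes from [expi_lipschitz], [n] from bounding the scalar product by sup norms, and
   pi^n from the integral of [decw]. *)
exists (2 * `|lam| * n%:R * C * pi ^+ n) => xi eta.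
have bnd y : normc (expi (- (lam * dotrV xi y)) * h y -
    expi (- (lam * dotrV eta y)) * h y) <=
    2 * `|lam| * n%:R * C * `|xi - eta| * decw y.
  rewrite -mulrBl normcM.
  rewrite (le_trans (ler_wpM2r (normc_ge0 _) (expi_lipschitz _ _)))//.
  rewrite opprK [- _ + _]addrC -mulrBr.
  have -> : dotrV eta y - dotrV xi y = dotrV (eta - xi) y.
    by rewrite /dotrV mulmxBl !mxE.
  rewrite normrM (distrC xi).
  set d := `|eta - xi|; set N := normc (h y).
  apply: (le_trans (y := 2 * `|lam| * n%:R * d * ((1 + `|y|) * N))).
    rewrite -!mulrA ler_wpM2l// ler_wpM2l// !mulrA ler_wpM2r ?normc_ge0//.
    rewrite (le_trans (norm_dotrV_le _ _))// ler_wpM2l ?mulr_ge0//.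
    by rewrite lerDr.
  rewrite (_ : 2 * `|lam| * n%:R * C * d * decw y =
    2 * `|lam| * n%:R * d * (C * decw y)); last by ring.
  by rewrite ler_wpM2l ?mulr_ge0// normr_ge0.
rewrite -[2 * `|lam| * n%:R * C * pi ^+ n * _]mulrAC.
have dR := integrable_decaying_Re (decaying_wave _).
have dI := integrable_decaying_Im (decaying_wave _).
split; apply: Rintegral_dist_le => // y; apply: le_trans (bnd y).
  by rewrite /= -Re_sub normc_Re_le.
by rewrite /= -Im_sub normc_Im_le.
Qed.

Lemma continuous_normc_fourier : continuous (fun xi => normc (fourier lam h xi)).
Proof.
have [K hK] := fourier_lipschitz.
have cR : continuous (fun xi => complex.Re (fourier lam h xi)).
  by apply: (@lipschitz_continuous _ _ _ _ K) => x y; have [] := hK x y.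
have cI : continuous (fun xi => complex.Im (fourier lam h xi)).
  by apply: (@lipschitz_continuous _ _ _ _ K) => x y; have [] := hK x y.
have cs : continuous (fun xi => complex.Re (fourier lam h xi) ^+ 2 +
                                complex.Im (fourier lam h xi) ^+ 2).
  by move=> x; exact: (cvgD (cvgM (cR x) (cR x)) (cvgM (cI x) (cI x))).
exact: (continuousT_comp cs (@sqrt_continuous R)).
Qed.

End fourier_continuity.

(** The index set may be uncountable, but a supremum of continuous functions is lower
    semicontinuous: the set where it exceeds [a] is a union of open sets. *)
Lemma measurable_ereal_sup n (I : Type) (J : I -> 'rV[R]_n -> R) :
  (forall x, continuous (J x)) ->
  measurable_fun setT (fun xi => ereal_sup (range (fun x => (J x xi)%:E))).
Proof.
move=> cJ; apply: (measurability _ (ErealGenOInfty.measurableE R)).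
move=> /= _ [_ [a ->]] <-; rewrite setTI; apply: open_measurable_rV.
rewrite preimage_itvoy.
rewrite (_ : [set _ | _] = \bigcup_x (J x @^-1` `]a, +oo[)).
  apply: bigcup_open => x _; apply: open_comp => [y _|]; first exact: cJ.
  exact: interval_open.
apply/seteqP; split=> xi /=.
  move=> /ereal_sup_gt[_ [x _ <-]]; rewrite lte_fin => ax.
  by exists x => //=; rewrite in_itv/= ax.
move=> [x _] /=; rewrite in_itv/= andbT => ax.
apply: (@lt_le_trans _ _ (J x xi)%:E); first by rewrite lte_fin.
by apply: ereal_sup_ubound; exists x.
Qed.

End gabor_transform.

(** * The pointwise estimate for the Gabor transform of a slice *)

Section restriction_estimate.
Context {R : realType}.
Local Notation mu := (@lebesgue_rV R).

Lemma dotrVZl n (c : R) (x y : 'rV[R]_n) : dotrV (c *: x) y = c * dotrV x y.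
Proof. by rewrite /dotrV -scalemxAl mxE. Qed.

Lemma dotrVZr n (c : R) (x y : 'rV[R]_n) : dotrV x (c *: y) = c * dotrV x y.
Proof. by rewrite /dotrV linearZ -scalemxAr mxE. Qed.

Lemma dotrV_row_mx m k (x : 'rV[R]_m) (z : 'rV[R]_k) (y : 'rV[R]_(m + k)) :
  dotrV (row_mx x z) y = dotrV x (lsubmx y) + dotrV z (rsubmx y).
Proof.
rewrite -{1}(hsubmxK y) !dotrVE big_split_ord/=; congr (_ + _);
  by apply: eq_bigr => j _; rewrite ?row_mxEl ?row_mxEr.
Qed.

(** This is the test function in [gabor], so the lemma allows [f] to be replaced by its continuous
    representative. The phases 0 and -pi/2 in [modulated] give the cosine and the sine. *)
Lemma schwartz_wave n (lam : R) (g : 'rV[R]_n -> R[i]) x xi : schwartz g ->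
  schwartz (fun y => expi (- (lam * dotrV xi y)) * ((g (y - x))^*)%C).
Proof.
move=> /schwartzP[gR gI]; pose a := (- lam) *: xi.
have aE y : - (lam * dotrV xi y) = dotrV a y by rewrite dotrVZl mulNr.
have wave theta f : rschwartz f ->
    fspan (modulated a x) (fun y => cos (dotrV a y + theta) * f (y - x)).
  by move=> fS; apply: fspan_base; exists theta, f.
apply/schwartzP; split; apply: (@modulated_rschwartz _ _ a x).
  rewrite (_ : _ \o _ = fun y =>
      cos (dotrV a y + 0) * (@complex.Re R \o g) (y - x) +
      cos (dotrV a y + - (pi / 2)) * (@complex.Im R \o g) (y - x)).
    by apply: fspan_add; exact: wave.
  apply/funext => y /=; rewrite Re_mul /= aE addr0 cosB cos_pihalf sin_pihalf.
  by case: (g (y - x)) => b c /=; ring.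
rewrite (_ : _ \o _ = fun y =>
    cos (dotrV a y + - (pi / 2)) * (@complex.Re R \o g) (y - x) +
    (-1) * (cos (dotrV a y + 0) * (@complex.Im R \o g) (y - x))).
  by apply: fspan_add; [|apply: fspan_scale]; exact: wave.
apply/funext => y /=; rewrite Im_mul /= aE addr0 cosB cos_pihalf sin_pihalf.
by case: (g (y - x)) => b c /=; ring.
Qed.

Lemma decaying_translate n (g : 'rV[R]_n -> R[i]) x : schwartz g ->
  decaying (fun y => ((g (y - x))^*)%C).
Proof.
move=> gS; have := schwartz_decaying (schwartz_wave 0 x 0 gS).
by under eq_fun do rewrite mul0r oppr0 /expi cos0 sin0 mul1r.
Qed.

Lemma decaying_slice m k (c : 'rV[R]_k) (h : 'rV[R]_(m + k) -> R[i]) :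
  decaying h -> decaying (fun y => h (row_mx y c)).
Proof.
move=> [hR hI [C hC]]; split.
- exact: (continuousT_comp (@continuous_row_mxl R m k c) hR).
- exact: (continuousT_comp (@continuous_row_mxl R m k c) hI).
- exists (C * decw c) => y; rewrite -mulrA (mulrC (decw c)) -decw_row_mx.
  apply: le_trans (hC _); rewrite ler_wpM2r ?normc_ge0// lerD2l.
  by rewrite -[in leLHS](row_mxKl y c) norm_lsubmx_le.
Qed.

Lemma gabor_distribution_of n (hbar : R) (g F : 'rV[R]_n -> R[i]) x xi :
  gabor hbar g (distribution_of F) x xi =
  ((2 * pi * hbar) `^ (- (n%:R / 2)))%:C%C *
  fourier hbar^-1 (fun y => F y * ((g (y - x))^*)%C) xi.
Proof. by rewrite /gabor /distribution_of; under eq_fun do rewrite mulrCA. Qed.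

Lemma gabor_eq n (hbar : R) (g : 'rV[R]_n -> R[i]) f1 f2 x xi :
  schwartz g -> eq_distribution f1 f2 -> gabor hbar g f1 x xi = gabor hbar g f2 x xi.
Proof. by move=> gS fE; rewrite /gabor fE//; exact: schwartz_wave. Qed.

Definition gabor_sup n (hbar : R) (g F : 'rV[R]_n -> R[i]) (xi : 'rV[R]_n) : \bar R :=
  ereal_sup (range (fun x => (normc (gabor hbar g (distribution_of F) x xi))%:E)).

Lemma normM_eq n (hbar : R) (g F : 'rV[R]_n -> R[i]) f : schwartz g ->
  eq_distribution f (distribution_of F) ->
  normM hbar g f = (\int[mu n]_xi gabor_sup hbar g F xi)%E.
Proof.
move=> gS fE; apply: eq_integral => xi _; rewrite /gabor_sup.
by under eq_fun do rewrite (gabor_eq _ _ _ gS fE).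
Qed.

Lemma gabor_sup_ge n (hbar : R) (g F : 'rV[R]_n -> R[i]) x xi :
  ((normc (gabor hbar g (distribution_of F) x xi))%:E <= gabor_sup hbar g F xi)%E.
Proof. by apply: ereal_sup_ubound; exists x. Qed.

Lemma gabor_sup_ge0 n (hbar : R) (g F : 'rV[R]_n -> R[i]) xi :
  (0 <= gabor_sup hbar g F xi)%E.
Proof. by apply: le_trans (gabor_sup_ge _ _ _ 0 _); rewrite lee_fin normc_ge0. Qed.

Lemma normc_real (r : R) : 0 <= r -> normc (r%:C)%C = r.
Proof. by move=> r0; rewrite /normc /= expr0n/= addr0 sqrtr_sqr ger0_norm. Qed.

Lemma measurable_gabor_sup n (hbar : R) (g F : 'rV[R]_n -> R[i]) :
  schwartz g -> bounded_continuous F ->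
  measurable_fun setT (gabor_sup hbar g F).
Proof.
move=> gS Fb; apply: (measurable_ereal_sup (J := fun x xi =>
  normc (gabor hbar g (distribution_of F) x xi))) => x.
have hd : decaying (fun y => F y * ((g (y - x))^*)%C).
  by apply: decayingM => //; exact: decaying_translate.
rewrite (_ : (fun xi => _) = fun xi => (2 * pi * hbar) `^ (- (n%:R / 2)) *
    normc (fourier hbar^-1 (fun y => F y * ((g (y - x))^*)%C) xi)).
  by move=> xi; exact: (cvgM (cvg_cst _) (@continuous_normc_fourier _ _ hbar^-1 _ hd xi)).
by apply/funext => xi; rewrite gabor_distribution_of normcM normc_real ?powR_ge0.
Qed.

(** The choice is conj(z)/|z|, and 0 for z = 0, whence a bound on the modulus in place of an
    equality. *)
Lemma exists_phase (z : R[i]) :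
  exists2 u, normc u <= 1 & complex.Re (u * z) = normc z.
Proof.
have [->|z0] := eqVneq z 0.
  exists 0; first by rewrite normc0.
  by rewrite mulr0 normc0.
have n0 : normc z != 0 by apply: contra z0 => /eqP/eq0_normc ->.
exists (z^*%C * ((normc z)^-1)%:C%C).
  rewrite normcM normc_real ?invr_ge0 ?normc_ge0//.
  rewrite (_ : normc z^*%C = normc z) ?mulfV//.
  by case: (z) => a b /=; rewrite sqrrN.
move: n0; case: z {z0} => a b; set r := normc _ => r0; simpc => /=.
have r2 : r ^+ 2 = a ^+ 2 + b ^+ 2.
  by rewrite /r /= sqr_sqrtr// addr_ge0 ?sqr_ge0.
apply: (mulfI r0); rewrite -expr2 r2; field.
exact: r0.
Qed.

(** The inversion inequality is applied to the real and imaginary parts of [H], the windowed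
    function with the wave in the first variables and the phase [u] included; the remaining
    frequency [z] is the variable of integration. *)
Lemma gabor_restriction_le m k (hbar : R) (g F : 'rV[R]_(m + k) -> R[i])
    (x xi : 'rV[R]_m) (c : 'rV[R]_k) : 0 < hbar ->
  schwartz g -> bounded_continuous F ->
  (((2 * pi * hbar) `^ (k%:R / 2))%:E *
   (normc (gabor hbar (fun y => g (row_mx y c)) (distribution_of (restriction F))
     x xi))%:E <= \int[mu k]_z gabor_sup hbar g F (row_mx xi z))%E.
Proof.
move=> h0 gS Fb; set lam := hbar^-1; have lam0 : 0 < lam by rewrite invr_gt0.
(* The centre has last block -c, so that on the subspace the window is evaluated at (y' - x, c). *)
pose G y := F y * ((g (y - row_mx x (- c)))^*)%C.
have Gd : decaying G by apply: decayingM => //; exact: decaying_translate.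
pose z0 := fourier lam (fun y => G (row_mx y 0)) xi.
set b := 2 * pi * hbar; have b0 : 0 < b by rewrite !mulr_gt0// pi_gt0.
set cn := b `^ (- ((m + k)%:R / 2)).
have cn0 : 0 < cn by rewrite powR_gt0.
have -> : gabor hbar (fun y => g (row_mx y c)) (distribution_of (restriction F)) x xi
    = (b `^ (- (m%:R / 2)))%:C%C * z0.
  rewrite gabor_distribution_of /z0 -/lam -/b.
  rewrite (_ : (fun y => restriction F y * _) = fun y => G (row_mx y 0))//.
  apply/funext => y.
  by rewrite /G /restriction opp_row_mx add_row_mx opprK add0r.
rewrite normcM normc_real ?powR_ge0//.
have [u u1 uz] := exists_phase z0.
pose H y := u * (expi (- (lam * dotrV xi (lsubmx y))) * G y).
have EGd : decaying (fun y => expi (- (lam * dotrV xi (lsubmx y))) * G y).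
  apply: decayingM => //; apply: bounded_continuous_expi.
  have cl := continuousT_comp (@continuous_lsubmx R m k)
    (@polyf_continuous _ _ _ (polyf_dotrV xi)).
  by move=> y; exact: (cvgN (cvgM (cvg_cst lam) (cl y))).
have Hd : decaying H by apply: decayingM => //; exact: bounded_continuous_cst.
have [C hC] := decaying_bound Hd.
pose S := gabor_sup hbar g F.
have mS : measurable_fun setT S by exact: measurable_gabor_sup.
have mSr : measurable_fun setT (fun z => S (row_mx xi z)).
  by apply: (measurableT_comp mS); exact: measurable_row_mxr.
(* The majorant is the supremum defining the norm, divided by the normalization [cn] of the
   transform in m + k variables. *)
have key := @inversion_inequality R m k lam C (@complex.Re R \o H)
  (@complex.Im R \o H) (fun z => (cn^-1)%:E * S (row_mx xi z))%E lam0
  (measurable_decaying_Re Hd) (measurable_decaying_Im Hd).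
have {key} : (((2 * pi / lam) ^+ k)%:E *
    \int[mu m]_y ((@complex.Re R \o H) (row_mx y 0))%:E <=
    \int[mu k]_z ((cn^-1)%:E * S (row_mx xi z)))%E.
  apply: key.
  - by move=> y; apply: le_trans (hC y); exact: normc_Re_le.
  - by move=> y; apply: le_trans (hC y); exact: normc_Im_le.
  - exact: measurable_funeM.
  - by move=> z; rewrite mule_ge0 ?lee_fin ?invr_ge0 ?(ltW cn0)// gabor_sup_ge0.
  - move=> z; pose W y := expi (- (lam * dotrV (row_mx xi z) y)) * G y.
    have Wd : decaying W by exact: decaying_wave.
    have uWd : decaying (fun y => u * W y).
      by apply: decayingM => //; exact: bounded_continuous_cst.
    have -> : (\int[mu (m + k)]_y (cos (dotrV z (lam *: rsubmx y)) *
        (@complex.Re R \o H) y + sin (dotrV z (lam *: rsubmx y)) *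
        (@complex.Im R \o H) y)%:E =
        (complex.Re (u * fourier lam G (row_mx xi z)))%:E)%E.
      rewrite -[u * _](Cintegral_mul Wd) (Cintegral_Re uWd).
      apply: eq_integral => y _; congr EFin.
      (* The wave of frequency (xi, z) factors, and its part in [xi] is already contained in [H]. *)
      have -> : u * W y = expi (- dotrV z (lam *: rsubmx y)) * H y.
        rewrite /W /H dotrV_row_mx mulrDr opprD expiD dotrVZr; ring.
      by rewrite Re_mul /= cosN sinN mulNr opprK.
    apply: (@le_trans _ _ ((cn^-1)%:E * (normc (gabor hbar g (distribution_of F)
        (row_mx x (- c)) (row_mx xi z)))%:E)%E); last first.
      by rewrite lee_wpmul2l ?lee_fin ?invr_ge0 ?(ltW cn0)// gabor_sup_ge.
    rewrite gabor_distribution_of normcM normc_real ?(ltW cn0)// -EFinM.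
    rewrite mulKf ?gt_eqF// lee_fin -/lam -/G.
    rewrite (le_trans (ler_norm _))// (le_trans (normc_Re_le _))// normcM.
    by rewrite ler_piMl ?normc_ge0.
  - by have [] := Hd.
(* On the slice the integral of [H] is u z0, whose real part is the modulus of [z0] by the choice of
   [u]. *)
have -> : (\int[mu m]_y ((@complex.Re R \o H) (row_mx y 0))%:E = (normc z0)%:E)%E.
  have wd : decaying (fun y => expi (- (lam * dotrV xi y)) * G (row_mx y 0)).
    exact: (decaying_wave lam (decaying_slice 0 Gd) xi).
  have uwd : decaying (fun y => u * (expi (- (lam * dotrV xi y)) * G (row_mx y 0))).
    by apply: decayingM => //; exact: bounded_continuous_cst.
  rewrite -uz /z0 /fourier -(Cintegral_mul wd) (Cintegral_Re uwd).
  by apply: eq_integral => y _; rewrite /H /= row_mxKl.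
rewrite ge0_integralZl//; last 2 first.
- by move=> z _; exact: gabor_sup_ge0.
- by rewrite lee_fin invr_ge0 ltW.
have cc : (cn%:E * (cn^-1)%:E = 1)%E by rewrite -EFinM mulfV ?gt_eqF.
rewrite -(@lee_pmul2l _ cn%:E)// [(cn%:E * ((cn^-1)%:E * _))%E]muleA cc mul1e.
apply: le_trans; rewrite -!EFinM lee_fin mulrA mulrA.
rewrite ler_wpM2r ?normc_ge0// /lam invrK -/b.
have powD r s : b `^ (r + s) = b `^ r * b `^ s.
  by rewrite powRD// (gt_eqF b0) implybT.
(* The exponents of [b] to be matched are k/2 - m/2 and k - (m+k)/2. *)
rewrite -powR_mulrn ?(ltW b0)// /cn -!powD natrD.
by rewrite le_eqVlt; apply/orP; left; apply/eqP; congr (b `^ _); field.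
Qed.

End restriction_estimate.

(** * The restriction to a subspace *)

Section temperedness.
Context {R : realType} (n : nat).
Local Notation mu := (@lebesgue_rV R).

Lemma CintegralD (f g : 'rV[R]_n -> R[i]) : decaying f -> decaying g ->
  Cintegral (mu n) (fun y => f y + g y) =
  Cintegral (mu n) f + Cintegral (mu n) g.
Proof.
move=> fd gd; apply/eqP; rewrite eq_complex /=.
have E (pr : R[i] -> R) : (forall z w, pr (z + w) = pr z + pr w) ->
    (mu n).-integrable setT (EFin \o (pr \o f)) ->
    (mu n).-integrable setT (EFin \o (pr \o g)) ->
    Rintegral (mu n) setT (pr \o (fun y => f y + g y)) ==
    Rintegral (mu n) setT (pr \o f) + Rintegral (mu n) setT (pr \o g).
  move=> prD fi gi; rewrite -RintegralD//; apply/eqP.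
  by apply: eq_Rintegral => y _ /=; rewrite prD.
apply/andP; split; apply: E.
- by move=> [? ?] [? ?].
- exact: integrable_decaying_Re.
- exact: integrable_decaying_Re.
- by move=> [? ?] [? ?].
- exact: integrable_decaying_Im.
- exact: integrable_decaying_Im.
Qed.

Lemma normc_Cintegral_le (h : 'rV[R]_n -> R[i]) B : decaying h ->
  (forall y, normc (h y) <= B * decw y) ->
  normc (Cintegral (mu n) h) <= 2 * (B * pi ^+ n).
Proof.
move=> hd hB; rewrite (le_trans (normc_le _))// mulr2n mulrDl mul1r.
have zi : (mu n).-integrable setT (EFin \o (fun=> 0 : R)) by exact: integrable0.
have z0 : Rintegral (mu n) setT (fun=> 0 : R) = 0.
  by rewrite /Rintegral integral0.
rewrite lerD// -[X in `|X|]subr0 -z0; apply: Rintegral_dist_le => //.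
- exact: integrable_decaying_Re.
- by move=> y; rewrite subr0 (le_trans _ (hB y))// normc_Re_le.
- exact: integrable_decaying_Im.
- by move=> y; rewrite subr0 (le_trans _ (hB y))// normc_Im_le.
Qed.

(** [decw_lower] consumes the orders 0 and 2n, both controlled by this seminorm; the bound is kept
    linear in [s] because [tempered] demands it. *)
Lemma schwartz_decw_le (phi : 'rV[R]_n -> R[i]) : schwartz phi ->
  exists2 s : R, schwartz_norm (2 * n) phi = s%:E &
    forall y, normc (phi y) <= 2 ^+ n * (2 * s) * decw y.
Proof.
move=> [_ /(_ (2 * n)%N)]; set S := schwartz_norm _ _ => Soo.
have S_ge k y : (k <= 2 * n)%N -> ((`|y| ^+ k * normc (phi y))%:E <= S)%E.
  move=> kn; apply: ereal_sup_ubound; exists k, [::], y; split => //.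
  by rewrite /Cpartial /=; case: (phi y).
move: S Soo S_ge => [s| |] // _ S_ge; last by have := S_ge 0%N 0 isT.
exists s => // y.
have := S_ge 0%N y isT; have := S_ge (2 * n)%N y (leqnn _).
rewrite !lee_fin expr0 mul1r => h2 h0.
apply: (le_trans (ler_peMr (normc_ge0 _) (decw_lower y))).
rewrite [leLHS]mulrA ler_wpM2r ?decw_ge0// mulrCA ler_wpM2l ?exprn_ge0//.
by rewrite mulrDr mulr1 mulr2n mulrDl mul1r lerD// mulrC.
Qed.

Lemma tempered_distribution_of (F : 'rV[R]_n -> R[i]) :
  bounded_continuous F -> tempered (distribution_of F).
Proof.
move=> Fb; have Fd phi : schwartz phi -> decaying (fun y => F y * phi y).
  by move=> phiS; apply: decayingM => //; exact: schwartz_decaying.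
split=> [a phi psi phiS psiS|].
  rewrite /distribution_of -(Cintegral_mul (Fd _ phiS)) -CintegralD; last 2 first.
  - by apply: decayingM; [exact: bounded_continuous_cst|exact: Fd].
  - exact: Fd.
  by congr (Cintegral _ _); apply/funext => y; ring.
have [_ _ [M FM]] := Fb; have M0 : 0 <= M := le_trans (normc_ge0 _) (FM 0).
exists (2 * n)%N, (2 * (M * (2 ^+ n * 2) * pi ^+ n)) => phi phiS.
have [s -> phis] := schwartz_decw_le phiS.
rewrite -EFinM lee_fin.
rewrite (_ : _ * s = 2 * (M * (2 ^+ n * (2 * s)) * pi ^+ n)); last by ring.
apply: normc_Cintegral_le; first exact: Fd.
by move=> y; rewrite normcM -mulrA ler_pM ?normc_ge0.
Qed.

End temperedness.

Section restriction_norm.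
Context {R : realType}.
Local Notation mu := (@lebesgue_rV R).

Lemma bounded_continuous_restriction m k (F : 'rV[R]_(m + k) -> R[i]) :
  bounded_continuous F -> bounded_continuous (restriction F).
Proof.
move=> [FR FI [M FM]]; split.
- exact: (continuousT_comp (@continuous_row_mxl R m k 0) FR).
- exact: (continuousT_comp (@continuous_row_mxl R m k 0) FI).
- by exists M => x; exact: FM.
Qed.

Lemma schwartz_slice m k (g : 'rV[R]_(m + k) -> R[i]) (c : 'rV[R]_k) :
  schwartz g -> schwartz (fun y => g (row_mx y c)).
Proof.
move=> /schwartzP[gR gI]; apply/schwartzP.
split; [exact: (sliced_rschwartz c gR)|exact: (sliced_rschwartz c gI)].
Qed.

(** The right side of the pointwise bound is free of [x], so it also bounds the supremum; Tonelli
    then merges the integrals over [xi] and [z]. The constant [A] is a parameter because the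
    estimate is used for two windows. *)
Lemma normM_restriction_le m k (hbar A : R) (g1 : 'rV[R]_m -> R[i])
    (g F : 'rV[R]_(m + k) -> R[i]) : 0 <= A ->
  schwartz g1 -> schwartz g -> bounded_continuous F ->
  (forall x xi, ((normc (gabor hbar g1 (distribution_of (restriction F)) x xi))%:E
     <= A%:E * \int[mu k]_z gabor_sup hbar g F (row_mx xi z))%E) ->
  (normM hbar g1 (distribution_of (restriction F)) <=
     A%:E * normM hbar g (distribution_of F))%E.
Proof.
move=> A0 g1S gS Fb gle.
have mS := measurable_gabor_sup hbar gS Fb.
have mI : measurable_fun setT
    (fun xi => \int[mu k]_z gabor_sup hbar g F (row_mx xi z))%E.
  apply: (measurable_fun_fubini_tonelli_F (m2 := mu k)
    (fun p => gabor_sup hbar g F (row_mx p.1 p.2))).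
    exact: measurable_comp_row_mx.
  by move=> p; exact: gabor_sup_ge0.
rewrite [X in (_ <= _ * X)%E](_ : _ = \int[mu (m + k)]_xi gabor_sup hbar g F xi)%E//.
rewrite ge0_integral_row_mx//; last by move=> xi; exact: gabor_sup_ge0.
rewrite -ge0_integralZl//; last first.
  by move=> xi _; apply: integral_ge0 => z _; exact: gabor_sup_ge0.
apply: ge0_le_integral => //.
- by move=> xi _; exact: gabor_sup_ge0.
- apply: measurable_gabor_sup => //; exact: bounded_continuous_restriction.
- exact: measurable_funeM.
- by move=> xi _; apply: ge_ereal_sup => _ [x _ <-]; exact: gle.
Qed.

End restriction_norm.

Section gaussian_slices.
Context {R : realType}.

Lemma quadf_diag k (hbar : R) (q x : 'rV[R]_k) :
  (2 * hbar)^-1 * dotrV x (x *m (diag_mx q)^T) = quadf ((2 * hbar)^-1 *: q) x.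
Proof.
rewrite dotrVE mulr_sumr; apply: eq_bigr => j _.
by rewrite tr_diag_mx mul_mx_diag !mxE; ring.
Qed.

(** The window is a generator of [gauss_tensor] whose polynomial is the normalizing constant. *)
Lemma schwartz_tensor_gaussian m k (hbar : R) (g : 'rV[R]_m -> R[i])
    (q : 'rV[R]_k) : 0 < hbar -> (forall j, 0 < q ord0 j) -> schwartz g ->
  schwartz (tensor g (gaussian_window hbar (diag_mx q))).
Proof.
move=> h0 q0 /schwartzP[gR gI]; set a := (2 * hbar)^-1 *: q.
have a0 j : 0 < a ord0 j by rewrite mxE mulr_gt0// invr_gt0 mulr_gt0.
apply/schwartzP; split; apply: (gauss_tensor_rschwartz a0); apply: fspan_base.
  exists (@complex.Re R \o g), (fun=> (2 * pi * hbar) `^ (- (k%:R / 2))).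
  split => //; first exact: polyf_cst.
  apply/funext => x; rewrite /= /tensor Re_mul /gaussian_window quadf_diag /=.
  by rewrite mulr0 subr0.
exists (@complex.Im R \o g), (fun=> (2 * pi * hbar) `^ (- (k%:R / 2))).
split => //; first exact: polyf_cst.
apply/funext => x; rewrite /= /tensor Im_mul /gaussian_window quadf_diag /=.
by rewrite mulr0 add0r.
Qed.

(** The window enters conjugated, and a real factor is unaffected by conjugation. *)
Lemma gabor_scale n (hbar r : R) (g F : 'rV[R]_n -> R[i]) x xi :
  schwartz g -> bounded_continuous F ->
  gabor hbar (fun y => g y * r%:C%C) (distribution_of F) x xi =
  r%:C%C * gabor hbar g (distribution_of F) x xi.
Proof.
move=> gS Fb; rewrite !gabor_distribution_of mulrCA; congr (_ * _).
have Gd : decaying (fun y => F y * ((g (y - x))^*)%C).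
  by apply: decayingM => //; exact: decaying_translate.
rewrite /fourier -(Cintegral_mul (decaying_wave _ Gd xi)).
congr (Cintegral _ _); apply/funext => y.
rewrite (_ : ((g (y - x) * r%:C%C)^*)%C = r%:C%C * ((g (y - x))^*)%C); first by ring.
by case: (g (y - x)) => u v; simpc; congr (_ +i* _)%C; ring.
Qed.

End gaussian_slices.

Theorem proposition5p2 (R : realType) (hbar : R) (hbar_gt0 : 0 < hbar)
  (hbar_le1 : hbar <= 1) (m n : nat) (m_ge1 : (1 <= m)%N) (lt_mn : (m < n)%N)
  (g' : 'rV[R]_m -> R[i]) (g'_window : window g')
  (q : 'rV[R]_(n - m)) (q_gt0 : forall j, 0 < q ord0 j)
  (f : distribution_on R (m + (n - m))) (f_in_M : in_M hbar f)
  (F : 'rV[R]_(m + (n - m)) -> R[i]) (F_bc : bounded_continuous F)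
  (fE : eq_distribution f (distribution_of F)) :
  in_M hbar (distribution_of (restriction F)) /\
  (normM hbar g' (distribution_of (restriction F)) <=
   normM hbar (tensor g' (gaussian_window hbar (diag_mx q))) f)%E.
Proof.
have Fr_bc := bounded_continuous_restriction F_bc.
have [g'S _] := g'_window.
set k := (n - m)%N in q q_gt0 f f_in_M F F_bc fE Fr_bc *.
set b := 2 * pi * hbar; have b0 : 0 < b by rewrite !mulr_gt0// pi_gt0.
set D := b `^ (k%:R / 2); have D0 : 0 < D by rewrite powR_gt0.
have DD : ((D^-1)%:E * D%:E = 1)%E by rewrite -EFinM mulVf ?gt_eqF.
split.
  split; first exact: tempered_distribution_of.
  have [_ [g [[gS g0] gfin]]] := f_in_M.
  have [x0 gx0] : exists x0, g x0 <> 0.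
    apply: contrapT => /forallNP g00; apply: g0; apply/funext => x.
    by apply: contrapT; exact: g00.
  (* Slicing at the last block of a point where [g] does not vanish keeps the window nonzero. *)
  pose g1 y := g (row_mx y (rsubmx x0)).
  have g1S : schwartz g1 by exact: schwartz_slice.
  exists g1; split.
    split=> // g1E; apply: gx0.
    by rewrite -(hsubmxK x0) -[LHS]/(g1 (lsubmx x0)) g1E.
  apply: (@le_lt_trans _ _ ((D^-1)%:E * normM hbar g (distribution_of F))%E).
    apply: normM_restriction_le => // [|x xi]; first by rewrite invr_ge0 ltW.
    have := gabor_restriction_le x xi (rsubmx x0) hbar_gt0 gS F_bc.
    rewrite -(@lee_pmul2l _ (D^-1)%:E)// ?lte_fin ?invr_gt0//.
    by rewrite [((D^-1)%:E * (D%:E * _))%E]muleA DD mul1e.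
  rewrite (_ : normM _ _ _ = normM hbar g f); last by rewrite (normM_eq hbar gS fE).
  by rewrite lte_mul_pinfty// lee_fin invr_ge0 ltW.
have tS := schwartz_tensor_gaussian hbar_gt0 q_gt0 g'S.
rewrite [leRHS](normM_eq _ tS fE) -[leRHS]mul1e.
apply: normM_restriction_le => // x xi; rewrite mul1e.
have := gabor_restriction_le x xi 0 hbar_gt0 tS F_bc.
(* The quadratic form vanishes at 0 for every [q]; the remaining constant is the inverse of [D] and
   cancels the factor of [gabor_restriction_le]. *)
have -> : (fun y => tensor g' (gaussian_window hbar (diag_mx q)) (row_mx y 0)) =
    (fun y => g' y * (D^-1)%:C%C).
  apply/funext => y; rewrite /tensor row_mxKl row_mxKr /gaussian_window.
  rewrite quadf_diag /quadf big1 => [|j _]; last by rewrite !mxE !mul0r mulr0.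
  by rewrite oppr0 expR0 mulr1 powRN.
rewrite gabor_scale// normcM normc_real ?invr_ge0 ?(ltW D0)//.
by rewrite -EFinM mulrA mulfV ?gt_eqF// mul1r.
Qed.
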